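(* Let $(u,v,P,\eta)$ be an extreme Stokes wave over infinite depth (a deep-water Stokes wave of greatest height) with wavelength $2\pi$ and speed $c>0$, written in the moving frame with a wave crest at $x=0$ and wave troughs at $x=\pm\pi$. Let $$\Omega_+=\{(x,y): 0<x<\pi,\ -\infty<y<\eta(x)\},\qquad S_+=\{(x,y): 0<x<\pi,\ y=\eta(x)\}.$$ Then, in the moving frame, the pressure satisfies $$P_x<0\quad\text{in }\Omega_+\text{ and along }S_+,$$ while $P_x=0$ along the crest-line $\{(0,y): y\in(-\infty,\eta(0)]\}$ and along the trough-line $\{(\pi,y): y\in(-\infty,\eta(\pi)]\}$.
   Context: Constants: $g>0$ (gravity), $c>0$ (wave speed), $P_0$ (atmospheric pressure). The moving frame has coordinates $x=X-ct$, $y=Y$, where $(X,Y)$ are physical coordinates; in it the flow is time-independent. Governing equations. The free surface is the graph $y=\eta(x)$, and the fluid domain is $\Omega=\{(x,y): x\in\mathbb{R},\ -\infty<y<\eta(x)\}$. The velocity $(u,v)$ and the pressure $P$ are functions of $(x,y)$ satisfying in $\Omega$ $$(u-c)u_x+vu_y=-P_x,\qquad (u-c)v_x+vv_y=-P_y-g,$$ $$u_x+v_y=0,\qquad u_y-v_x=0,$$ with boundary conditions $P=P_0$ and $v=(u-c)\eta'$ on $y=\eta(x)$, and $(u,v)\to(0,0)$ uniformly in $x$ as $y\to-\infty$. There is no surface tension. Consequently $u,v$ are harmonic in $\Omega$, and Bernoulli's law $\frac{(u-c)^2+v^2}{2}+gy+P=Q$ holds with $Q$ constant on $\overline{\Omega}$.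 Stokes wave. $\eta,u,v,P$ are $2\pi$-periodic in $x$; $\eta,u,P$ are even in $x$ and $v$ is odd in $x$. Wave crests are located at $x\in2\pi\mathbb{Z}$ and wave troughs at $x\in\pi+2\pi\mathbb{Z}$. A regular Stokes wave is such a solution with $u-c<0$ on $\overline{\Omega}$. Extreme Stokes wave (wave of greatest height). It is a Stokes wave with a stagnation point at each crest: $u-c\le0$ on $\overline{\Omega}$, with equality at the wave crests, where $(u,v)=(c,0)$. The velocity field is continuous on $\overline{\Omega}$, including the crests. The free surface is regular between successive crests; at each crest the profile has a corner with contained angle $120^\circ$, and $\eta$ is convex between successive crests (on $[0,2\pi]$). The wave is obtained as a limit of regular Stokes waves in the following sense. Let $\psi$ be the stream function ($\psi_y=u-c$, $\psi_x=-v$, $\psi=0$ on $y=\eta$) and $\phi$ the velocity potential ($\phi_x=u-c$, $\phi_y=v$, $\phi=0$ on the crest-line $x=0$). Put $q=-\phi$, $p=-\psi$, let $\gamma:q+ip\mapsto x+iy$ be the inverse of the resulting map, and let $h(q,p)=y$ be the height function. Then there are regular Stokes waves with height functions $h_n$ and maps $\gamma_n$ such that $h_n(\cdot,0)\to h(\cdot,0)$ weakly in the periodic Sobolev space $W^{1,k}_{\rm per}(\mathbb{R})$ for $k\in(1,3)$, hence in the Hölder space $C^{0,\alpha}_{\rm per}(\mathbb{R})$ for $\alpha\in(0,\frac23)$, and $\gamma_n\to\gamma$ in $C^{0,\alpha}_{\rm per}(\mathbb{R}\times(-\infty,0])$ (periodicity with respect to $q$). *)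

(* Defs.v *)
From HB Require Import structures.
From mathcomp Require Import all_boot all_order all_algebra.
From mathcomp Require Import all_classical all_reals all_analysis.
Import Order.TTheory GRing.Theory Num.Theory.
Import numFieldNormedType.Exports.

Set Implicit Arguments.
Unset Strict Implicit.
Unset Printing Implicit Defensive.

Local Open Scope ring_scope.
Local Open Scope classical_set_scope.

Section Calculus.
Variable R : realType.

Definition dx (f : R * R -> R) (z : R * R) : R :=
  derive1 (fun s : R => f (s, z.2)) z.1.

Definition dy (f : R * R -> R) (z : R * R) : R :=
  derive1 (fun s : R => f (z.1, s)) z.2.

Definition C1_on (D : set (R * R)) (f : R * R -> R) : Prop :=
  forall z, D z ->
    [/\ derivable (fun s : R => f (s, z.2)) z.1 1,
        derivable (fun s : R => f (z.1, s)) z.2 1,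
        {for z, continuous (dx f)} & {for z, continuous (dy f)}].

(* f is C^1 in the open set D, continuous on its closure, and its gradient
   extends continuously to the points of B. *)
Definition C1_upto (D B : set (R * R)) (f : R * R -> R) : Prop :=
  [/\ C1_on D f,
      {within closure D, continuous f} &
      forall z, B z ->
        cvg (dx f @ within D (nbhs z)) /\ cvg (dy f @ within D (nbhs z))].

Definition local_max (f : R -> R) (x : R) : Prop := \forall y \near x, f y <= f x.

Definition local_min (f : R -> R) (x : R) : Prop := \forall y \near x, f x <= f y.

(* The graph of f has at x one-sided tangents, of slopes sl and sr, and the
   angle they contain below the graph is a. *)
Definition corner (f : R -> R) (x a : R) : Prop :=
  exists sl sr : R,
    [/\ h^-1 * (f (x + h) - f x) @[h --> 0^'-] --> sl,
        h^-1 * (f (x + h) - f x) @[h --> 0^'+] --> sr &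
        pi - atan sl + atan sr = a].

End Calculus.

Section FunctionSpaces.
Variable R : realType.

Definition smooth_periodic (f : R -> R) : Prop :=
  periodic f (pi *+ 2) /\ forall n x, derivable (derive1n n f) x 1.

Definition Lk_norm (k : R) (f : R -> R) : \bar R :=
  'N[ @lebesgue_measure R ]_(k%:E) [EFin \o (f \_ `[0, pi *+ 2])].

Definition Lk_per (k : R) (f : R -> R) : Prop :=
  [/\ periodic f (pi *+ 2), measurable_fun [set: R] f & (Lk_norm k f < +oo)%E].

Definition weak_derivative (f f' : R -> R) : Prop :=
  forall t, smooth_periodic t ->
    \int[@lebesgue_measure R]_(x in `[0, pi *+ 2]) (f x * derive1 t x) =
    - \int[@lebesgue_measure R]_(x in `[0, pi *+ 2]) (f' x * t x).

(* f belongs to the 2pi-periodic Sobolev space W^{1,k}, with weak derivative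
   f' (which is determined only almost everywhere). *)
Definition sobolev_per (k : R) (f f' : R -> R) : Prop :=
  [/\ Lk_per k f, Lk_per k f' & weak_derivative f f'].

(* Only the values of l on W^{1,k} matter. *)
Definition sobolev_dual (k : R) (l : (R -> R) -> R) : Prop :=
  (forall a f1 f1' f2 f2', sobolev_per k f1 f1' -> sobolev_per k f2 f2' ->
     l (fun x => a * f1 x + f2 x) = a * l f1 + l f2) /\
  (exists C : R, forall f f', sobolev_per k f f' ->
     `|l f| <= C * fine (Lk_norm k f + Lk_norm k f')%E).

Definition sobolev_weak_cvg (k : R) (F : nat -> R -> R) (f : R -> R) : Prop :=
  [/\ forall n, exists f', sobolev_per k (F n) f',
      exists f', sobolev_per k f f' &
      forall l, sobolev_dual k l -> l (F n) @[n --> \oo] --> l f].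

(* The C^{0,a} norm over D of F n - f tends to 0. *)
Definition holder_cvg (V W : normedModType R) (D : set V) (a : R)
    (F : nat -> V -> W) (f : V -> W) : Prop :=
  forall e : R, 0 < e -> \forall n \near \oo,
    (forall s, D s -> `|F n s - f s| <= e) /\
    (forall s t, D s -> D t ->
       `|(F n s - f s) - (F n t - f t)| <= e * `|s - t| `^ a).

End FunctionSpaces.

Section Waves.
Variable R : realType.
Implicit Types (g c patm : R) (eta : R -> R) (u v P : R * R -> R).

Definition crest_abscissa : set R := [set x | exists m : int, x = m%:~R * (pi *+ 2)].

Definition trough_abscissa : set R :=
  [set x | exists m : int, x = pi + m%:~R * (pi *+ 2)].

Definition fluid eta : set (R * R) := [set z | z.2 < eta z.1].

Definition surface eta : set (R * R) := [set z | z.2 = eta z.1].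

Definition half_fluid eta : set (R * R) :=
  [set z | [/\ 0 < z.1, z.1 < pi & z.2 < eta z.1]].

Definition half_surface eta : set (R * R) :=
  [set z | [/\ 0 < z.1, z.1 < pi & z.2 = eta z.1]].

(* Stokes wave of wavelength 2pi in the moving frame.  The set sing contains
   the abscissae at which the free surface is allowed not to be regular.
   Crests and troughs are the local maxima and minima of the profile.  The
   values of u, v and P outside the closure of the fluid are irrelevant. *)
Record stokes_wave (sing : set R) g c patm eta u v P : Prop := {
  sw_gravity : 0 < g;
  sw_speed : 0 < c;
  sw_eta_continuous : continuous eta;
  sw_eta_C1 : forall x, ~ sing x -> derivable eta x 1 /\ {for x, continuous (derive1 eta)};
  sw_u_C1 : C1_upto (fluid eta) (surface eta `\` [set z | sing z.1]) u;
  sw_v_C1 : C1_upto (fluid eta) (surface eta `\` [set z | sing z.1]) v;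
  sw_P_C1 : C1_upto (fluid eta) (surface eta `\` [set z | sing z.1]) P;
  sw_euler_x : forall z, fluid eta z ->
    (u z - c) * dx u z + v z * dy u z = - dx P z;
  sw_euler_y : forall z, fluid eta z ->
    (u z - c) * dx v z + v z * dy v z = - dy P z - g;
  sw_mass : forall z, fluid eta z -> dx u z + dy v z = 0;
  sw_irrotational : forall z, fluid eta z -> dy u z - dx v z = 0;
  sw_dynamic : forall x, P (x, eta x) = patm;
  sw_kinematic : forall x, ~ sing x ->
    v (x, eta x) = (u (x, eta x) - c) * derive1 eta x;
  sw_depth : forall e : R, 0 < e -> \forall y \near -oo,
    forall x, fluid eta (x, y) -> `|u (x, y)| < e /\ `|v (x, y)| < e;
  sw_eta_periodic : periodic eta (pi *+ 2);
  sw_u_periodic : forall x y : R, closure (fluid eta) (x, y) ->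
    u (x + pi *+ 2, y) = u (x, y);
  sw_v_periodic : forall x y : R, closure (fluid eta) (x, y) ->
    v (x + pi *+ 2, y) = v (x, y);
  sw_P_periodic : forall x y : R, closure (fluid eta) (x, y) ->
    P (x + pi *+ 2, y) = P (x, y);
  sw_eta_even : forall x, eta (- x) = eta x;
  sw_u_even : forall x y : R, closure (fluid eta) (x, y) ->
    u (- x, y) = u (x, y);
  sw_v_odd : forall x y : R, closure (fluid eta) (x, y) ->
    v (- x, y) = - v (x, y);
  sw_P_even : forall x y : R, closure (fluid eta) (x, y) ->
    P (- x, y) = P (x, y);
  sw_crests : forall x, local_max eta x <-> crest_abscissa x;
  sw_troughs : forall x, local_min eta x <-> trough_abscissa x
}.

Definition regular_stokes_wave g c patm eta u v P : Prop :=
  stokes_wave set0 g c patm eta u v P /\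
  forall z, closure (fluid eta) z -> u z - c < 0.

Definition stream_function c eta u v (psi : R * R -> R) : Prop :=
  [/\ C1_on (fluid eta) psi, {within closure (fluid eta), continuous psi},
      forall z, fluid eta z -> dy psi z = u z - c /\ dx psi z = - v z &
      forall x, psi (x, eta x) = 0].

Definition velocity_potential c eta u v (phi : R * R -> R) : Prop :=
  [/\ C1_on (fluid eta) phi, {within closure (fluid eta), continuous phi},
      forall z, fluid eta z -> dx phi z = u z - c /\ dy phi z = v z &
      forall y, y <= eta 0 -> phi (0, y) = 0].

Definition lower_half_plane : set (R * R) := [set s | s.2 <= 0].

(* gamma, as a map (q, p) |-> (x, y) from the closed lower half-plane onto the
   closure of the fluid, is the inverse of (x, y) |-> (- phi, - psi).  The
   height function is h s = (gamma s).2. *)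
Definition hodograph_map c eta u v (gamma : R * R -> R * R) : Prop :=
  exists phi psi : R * R -> R,
    [/\ velocity_potential c eta u v phi, stream_function c eta u v psi,
        forall s, lower_half_plane s ->
          closure (fluid eta) (gamma s) /\ (- phi (gamma s), - psi (gamma s)) = s &
        forall z, closure (fluid eta) z ->
          lower_half_plane (- phi z, - psi z) /\ gamma (- phi z, - psi z) = z].

(* For a wave of speed c, gamma s - (s.1 / c, 0) has period 2 * pi * c in
   q = s.1.  Measuring q and p in units of c gives all waves the same period
   2 * pi, so that waves of different speeds can be compared. *)
Definition rescaled (T : Type) c (f : R * R -> T) (s : R * R) : T :=
  f (c * s.1, c * s.2).

Definition surface_height c (gamma : R * R -> R * R) (q : R) : R :=
  (rescaled c gamma (q, 0)).2.

(* Along the approximating sequence the physical constants may vary too: with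
   the wavelength fixed, c^2 / g depends on the wave.  The maps gamma are not
   periodic themselves, but their differences after rescaling are. *)
Definition limit_of_regular_waves c eta u v : Prop :=
  exists (gamma : R * R -> R * R)
         (g_ c_ patm_ : nat -> R) (eta_ : nat -> R -> R)
         (u_ v_ P_ : nat -> R * R -> R) (gamma_ : nat -> R * R -> R * R),
    [/\ hodograph_map c eta u v gamma,
        forall n, regular_stokes_wave (g_ n) (c_ n) (patm_ n) (eta_ n) (u_ n) (v_ n) (P_ n) /\
          hodograph_map (c_ n) (eta_ n) (u_ n) (v_ n) (gamma_ n),
        forall k : R, 1 < k -> k < 3 ->
          sobolev_weak_cvg k (fun n => surface_height (c_ n) (gamma_ n))
            (surface_height c gamma),
        forall a : R, 0 < a -> a < 2 / 3 ->
          holder_cvg (V := R^o) (W := R^o) setT a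
            (fun n => surface_height (c_ n) (gamma_ n)) (surface_height c gamma) &
        forall a : R, 0 < a -> a < 2 / 3 ->
          holder_cvg lower_half_plane a
            (fun n => rescaled (c_ n) (gamma_ n)) (rescaled c gamma)].

Record extreme_stokes_wave g c patm eta u v P : Prop := {
  esw_stokes : stokes_wave crest_abscissa g c patm eta u v P;
  esw_speed_le : forall z, closure (fluid eta) z -> u z - c <= 0;
  esw_stagnation : forall x, crest_abscissa x ->
    u (x, eta x) = c /\ v (x, eta x) = 0;
  esw_corner : forall x, crest_abscissa x -> corner eta x (2 / 3 * pi);
  esw_convex : @convex_function R R^o `[0, pi *+ 2] eta;
  esw_limit : limit_of_regular_waves c eta u v
}.

End Waves.

(* Main.v *)
Require Import Defs.
From mathcomp Require Import all_boot all_order all_algebra.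
From mathcomp Require Import all_classical all_reals all_analysis.
From mathcomp Require Import ring lra zify.
Import Order.TTheory GRing.Theory Num.Theory.
Import numFieldNormedType.Exports.

(* Let w = (u - c) - i v, which is holomorphic in the fluid.  Bernoulli's law
   P = patm + g (eta 0 - y) - |w|^2 / 2 gives P_x = - (|w|^2)_x / 2, so the
   claim in the fluid is that ln |w|^2, a harmonic function because u < c
   there, increases strictly with x for 0 < x < pi.  On the surface
   |w|^2 = 2 g (eta 0 - y), while P > patm inside since P is superharmonic:
   among all points at a given height, the speed is largest on the surface.

   Fix 0 < x0 < pi and compare ln |w|^2 over x0 < x < x0 + pi with its mirror
   image in the line x = x0.  Since eta is even, periodic and convex between
   the crests, the mirror image of this part of the fluid lies in the fluid
   and stays away from the crest.  The difference vanishes on both vertical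
   sides (parity and periodicity), is nonnegative on the surface by the
   previous remark, and tends to 0 at infinite depth.  The maximum principle
   makes it positive, and Hopf's boundary point lemma on x = x0 gives
   P_x < 0 there.

   At a surface point, Hopf's lemma is applied to P - patm in the half-plane
   below the tangent, which lies in the fluid by convexity; as the slope of the
   surface is negative, the horizontal line through the point enters this
   half-plane on its left, and the growth of P along it bounds P_x.

   The velocity is only known to be C^1, so harmonic functions are represented
   by pairs satisfying the Cauchy-Riemann equations.  The angular derivative of
   the conjugate function makes the circle means of the first one constant, and
   this yields the maximum principle without second derivatives. *)

Set Implicit Arguments.
Unset Strict Implicit.
Unset Printing Implicit Defensive.

Local Open Scope ring_scope.
Local Open Scope classical_set_scope.

(** * Cauchy-Riemann pairs and their means over circles *)

Section CauchyRiemann.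
Variable R : realType.
Implicit Types (p z : R * R) (F G H a b : R * R -> R).

Lemma continuous_fst2 : continuous (fun z : R * R => z.1).
Proof. by move=> z; exact: (@cvg_fst _ _ (nbhs z.1) (nbhs z.2) _). Qed.

Lemma continuous_snd2 : continuous (fun z : R * R => z.2).
Proof. by move=> z; exact: (@cvg_snd _ _ (nbhs z.1) (nbhs z.2) _). Qed.

Lemma nearP2 p (Q : set (R * R)) :
  (\forall z \near p, Q z) <->
  exists2 r : R, 0 < r &
    forall x y : R, `|x - p.1| < r -> `|y - p.2| < r -> Q (x, y).
Proof.
split.
  move=> /nbhs_ballP[r /= r0 Qr]; exists r => // x y xr yr.
  by apply: Qr; split; rewrite -ball_normE /ball_/= distrC.
move=> [r r0 Qr]; apply/nbhs_ballP; exists r => //= -[x y] [].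
by rewrite -ball_normE /ball_/= => xr yr; apply: Qr; rewrite distrC.
Qed.

Lemma cvg2P p F : {for p, continuous F} <->
  forall e : R, 0 < e -> exists2 r : R, 0 < r &
    forall x y : R, `|x - p.1| < r -> `|y - p.2| < r -> `|F (x, y) - F p| < e.
Proof.
split.
  move=> /cvgrPdist_lt Fp e /Fp/nearP2[r r0 Fr]; exists r => // x y xr yr.
  by rewrite distrC; exact: Fr.
move=> Fp; apply/cvgrPdist_lt => e /Fp[r r0 Fr]; apply/nearP2; exists r => // x y xr yr.
by rewrite distrC; exact: Fr.
Qed.

Lemma is_derive1P (f : R -> R) (x l : R) : is_derive x 1 f l <->
  forall e : R, 0 < e -> exists2 r : R, 0 < r &
    forall h, `|h| < r -> `|f (x + h) - f x - l * h| <= e * `|h|.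
Proof.
split.
  move=> [df <-] e e0.
  move: df; rewrite /derivable/derive => /cvgrPdist_le/(_ e e0).
  move=> /nbhs_ballP[r /= r0 fr]; exists r => // h hr.
  have [->|h0] := eqVneq h 0; first by rewrite addr0 mulr0 subr0 subrr normr0 mulr0.
  have /= := fr h; rewrite -ball_normE /ball_/= sub0r normrN => /(_ hr h0).
  rewrite scaler1 distrC [h + x]addrC => fe.
  rewrite -ler_pdivrMr ?normr_gt0// -normf_div.
  by apply: le_trans fe; rewrite mulrBl mulfK// mulrC.
move=> fe.
have cf : h^-1 *: (f (h *: 1 + x) - f x) @[h --> 0^'] --> l.
  apply/cvgrPdist_le => e /fe[r r0 fr]; apply/nbhs_ballP; exists r => //= h.
  rewrite -ball_normE /ball_/= sub0r normrN => hr h0.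
  rewrite scaler1 distrC [h + x]addrC.
  have := fr _ hr; rewrite -ler_pdivrMr ?normr_gt0// -normf_div mulrBl mulfK//.
  by rewrite [_ / h]mulrC.
by split; [apply/cvg_ex; exists l|apply/cvg_lim].
Qed.

Lemma is_derive_continuous (f : R -> R) (x l : R) :
  is_derive x 1 f l -> {for x, continuous f}.
Proof. by move=> [df _]; exact/differentiable_continuous/derivable1_diffP. Qed.

(** The hypothesis is over the ball of radius [|y - x|] about [x], so that the order of [x] and [y]
    does not matter when moving inside a square neighbourhood. *)
Lemma MVT_is_derive (f df : R -> R) (x y : R) :
  (forall s, `|s - x| <= `|y - x| -> is_derive s 1 f (df s)) ->
  exists2 s, `|s - x| <= `|y - x| & f y - f x = df s * (y - x).
Proof.
move=> fdf.
have cf s : `|s - x| <= `|y - x| -> {for s, continuous f}.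
  by move=> /fdf/is_derive_continuous.
have [xy|yx] := leP x y.
  have fdf' s : s \in `]x, y[%R -> is_derive s 1 f (df s).
    rewrite in_itv/= => /andP[xs sy]; apply: fdf.
    by rewrite !ger0_norm ?subr_ge0 ?(ltW xs)// lerD2r ltW.
  have wf : {within `[x, y], continuous f}.
    apply/subspace_continuousP => s /=; rewrite in_itv/= => /andP[xs sy].
    apply: cvg_within_filter; apply: cf.
    by rewrite !ger0_norm ?subr_ge0// lerD2r.
  have [s] := MVT_segment xy fdf' wf.
  rewrite in_itv/= => /andP[xs sy] e; exists s => //.
  by rewrite !ger0_norm ?subr_ge0// lerD2r.
have yx' := ltW yx.
have dist s : y <= s -> s <= x -> `|s - x| <= `|y - x|.
  by move=> ys sx; rewrite distrC [leRHS]distrC !ger0_norm ?subr_ge0// lerD2l lerN2.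
have fdf' s : s \in `]y, x[%R -> is_derive s 1 f (df s).
  by rewrite in_itv/= => /andP[ys sx]; apply: fdf; apply: dist; exact: ltW.
have wf : {within `[y, x], continuous f}.
  apply/subspace_continuousP => s /=; rewrite in_itv/= => /andP[ys sx].
  by apply: cvg_within_filter; apply: cf; exact: dist.
have [s] := MVT_segment yx' fdf' wf.
rewrite in_itv/= => /andP[ys sx] e; exists s; first exact: dist.
by rewrite -opprB e; ring.
Qed.

(** The partial derivatives are explicit functions rather than [dx F] and [dy F], so that one pair
    can serve, up to sign and order, for a function and for its conjugate. *)
Definition partials_near F a b p : Prop :=
  \forall z \near p, [/\ is_derive (z : R * R).1 1 (fun s => F (s, z.2)) (a z),
    is_derive z.2 1 (fun s => F (z.1, s)) (b z),
    {for z, continuous a} & {for z, continuous b}].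

(** A vertical and then a horizontal segment lead from [p] to [(x, y)]; the mean value theorem on
    each turns the remainder into increments of [a] and [b], which are small by continuity at
    [p]. *)
Lemma partials_frechet F a b p : partials_near F a b p ->
  forall e : R, 0 < e -> exists2 r : R, 0 < r &
    forall x y : R, `|x - p.1| < r -> `|y - p.2| < r ->
      `|F (x, y) - F p - a p * (x - p.1) - b p * (y - p.2)| <=
      e * (`|x - p.1| + `|y - p.2|).
Proof.
move=> Fab e e0.
have [_ _ /cvg2P/(_ e e0)[r1 r10 ar] /cvg2P/(_ e e0)[r2 r20 br]] := nbhs_singleton Fab.
have /nearP2[r3 r30 Fr] := Fab.
pose r := Num.min r1 (Num.min r2 r3).
have r0 : 0 < r by rewrite /r !lt_min r10 r20 r30.
exists r => // x y xr yr.
have lt s x' : `|s - p.1| <= `|x' - p.1| -> `|x' - p.1| < r -> `|s - p.1| < r.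
  exact: le_lt_trans.
have [s sx Fs] : exists2 s, `|s - p.1| <= `|x - p.1| &
    F (x, y) - F (p.1, y) = a (s, y) * (x - p.1).
  apply: (MVT_is_derive (f := fun s => F (s, y)) (df := fun s => a (s, y))) => s' sx.
  have := le_lt_trans sx xr; move: yr; rewrite /r !lt_min => /and3P[_ _ yr] /and3P[_ _ sr].
  by have [] := Fr s' y sr yr.
have [t ty Ft] : exists2 t, `|t - p.2| <= `|y - p.2| &
    F (p.1, y) - F (p.1, p.2) = b (p.1, t) * (y - p.2).
  apply: (MVT_is_derive (f := fun s => F (p.1, s)) (df := fun s => b (p.1, s))) => s' sy.
  have := le_lt_trans sy yr; rewrite /r !lt_min => /and3P[_ _ sr].
  by have [] := Fr p.1 s'; rewrite // subrr normr0.
have sr := le_lt_trans sx xr; have tr := le_lt_trans ty yr.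
move: sr tr yr; rewrite /r !lt_min => /and3P[s1 s2 s3] /and3P[t1 t2 t3] /and3P[y1 y2 y3].
have pE : F p = F (p.1, p.2) by case: (p).
have -> : F (x, y) - F p - a p * (x - p.1) - b p * (y - p.2) =
    (a (s, y) - a p) * (x - p.1) + (b (p.1, t) - b p) * (y - p.2).
  rewrite !mulrBl -Fs -Ft pE; ring.
rewrite (le_trans (ler_normD _ _))// [e * _]mulrDr !normrM.
apply: lerD; apply: ler_wpM2r => //; apply: ltW.
  exact: ar.
by apply: br => //; rewrite subrr normr0.
Qed.

Lemma partials_continuous F a b p : partials_near F a b p -> {for p, continuous F}.
Proof.
move=> Fab; apply/cvg2P => e e0.
have [r r0 Fr] := partials_frechet Fab ltr01.
pose C := `|a p| + `|b p| + 2.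
have C0 : 0 < C by rewrite /C ltr_wpDl// addr_ge0.
exists (Num.min r (e / C)); first by rewrite lt_min r0 divr_gt0.
move=> x y; rewrite !lt_min => /andP[xr xe] /andP[yr ye].
have h := Fr x y xr yr.
have -> : F (x, y) - F p = (F (x, y) - F p - a p * (x - p.1) - b p * (y - p.2)) +
   (a p * (x - p.1) + b p * (y - p.2)) by ring.
rewrite (le_lt_trans (ler_normD _ _))//.
have h1 : `|a p * (x - p.1) + b p * (y - p.2)| <= `|a p| * `|x - p.1| + `|b p| * `|y - p.2|.
  by rewrite (le_trans (ler_normD _ _))// !normrM.
apply: le_lt_trans (lerD h h1) _.
have -> : e = `|a p| * (e / C) + `|b p| * (e / C) + (e / C + e / C).
  by rewrite /C; field; rewrite gt_eqF.
rewrite mul1r addrC ler_ltD//; last by rewrite ltrD.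
by rewrite lerD// ler_wpM2l// ltW.
Qed.

Lemma partials_chain F a b (x y : R -> R) (t x' y' : R) :
  partials_near F a b (x t, y t) -> is_derive t 1 x x' -> is_derive t 1 y y' ->
  is_derive t 1 (fun s => F (x s, y s)) (a (x t, y t) * x' + b (x t, y t) * y').
Proof.
move=> Fab dx dy; apply/is_derive1P => e e0.
set p := (x t, y t).
pose C := `|x'| + `|y'| + 2.
have C0 : 0 < C by rewrite /C ltr_wpDl// addr_ge0.
(* Half of [e] pays for the remainder of [F], through [e1], the other half for those of [x] and [y],
   through [e2]. Capping [e2] by 1 bounds the increments of [x] and [y] by [|x'| + 1] and [|y'| + 1]
   times [|h|]. *)
pose e1 := e / (2 * C).
have e10 : 0 < e1 by rewrite divr_gt0// mulr_gt0.
have [r r0 Fr] := partials_frechet Fab e10.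
pose D := `|a p| + `|b p| + 2.
have D0 : 0 < D by rewrite /D ltr_wpDl// addr_ge0.
pose e2 := Num.min 1 (e / (2 * D)).
have e20 : 0 < e2 by rewrite lt_min ltr01/= divr_gt0// mulr_gt0.
have /is_derive1P/(_ _ e20)[r1 r10 xr] := dx.
have /is_derive1P/(_ _ e20)[r2 r20 yr] := dy.
have rC : 0 < r / C by rewrite divr_gt0.
exists (Num.min r1 (Num.min r2 (r / C))); first by rewrite !lt_min r10 r20 rC.
move=> h; rewrite !lt_min => /and3P[h1 h2 h3].
have [{}xr {}yr] := (xr _ h1, yr _ h2).
have h0 := normr_ge0 h.
have e21 : e2 <= 1 by rewrite /e2 ge_min lexx.
have bx : `|x (t + h) - x t| <= (`|x'| + 1) * `|h|.
  have -> : x (t + h) - x t = (x (t + h) - x t - x' * h) + x' * h by ring.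
  rewrite (le_trans (ler_normD _ _))// mulrDl addrC normrM lerD2l.
  by rewrite (le_trans xr)// ler_wpM2r.
have by' : `|y (t + h) - y t| <= (`|y'| + 1) * `|h|.
  have -> : y (t + h) - y t = (y (t + h) - y t - y' * h) + y' * h by ring.
  rewrite (le_trans (ler_normD _ _))// mulrDl addrC normrM lerD2l.
  by rewrite (le_trans yr)// ler_wpM2r.
have hC : C * `|h| < r by rewrite mulrC -ltr_pdivlMr.
have xC : `|x (t + h) - x t| < r.
  apply: le_lt_trans hC; apply: (le_trans bx); rewrite ler_wpM2r// /C.
  by have := normr_ge0 y'; lra.
have yC : `|y (t + h) - y t| < r.
  apply: le_lt_trans hC; apply: (le_trans by'); rewrite ler_wpM2r// /C.
  by have := normr_ge0 x'; lra.
have := Fr _ _ xC yC; rewrite /= -/p => Fe.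
have -> : F (x (t + h), y (t + h)) - F p - (a p * x' + b p * y') * h =
  (F (x (t + h), y (t + h)) - F p - a p * (x (t + h) - x t) - b p * (y (t + h) - y t)) +
  (a p * (x (t + h) - x t - x' * h) + b p * (y (t + h) - y t - y' * h)) by ring.
rewrite (le_trans (ler_normD _ _))//.
have -> : e * `|h| = e1 * (C * `|h|) + D * (e / (2 * D)) * `|h|.
  by rewrite /e1; field; rewrite !gt_eqF.
apply: lerD.
  apply: (le_trans Fe); rewrite ler_pM2l//.
  have -> : C * `|h| = (`|x'| + 1) * `|h| + (`|y'| + 1) * `|h| by rewrite /C; ring.
  exact: lerD.
rewrite (le_trans (ler_normD _ _))// !normrM.
have e2D : e2 * `|h| <= e / (2 * D) * `|h| by rewrite ler_wpM2r// /e2 ge_min lexx orbT.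
have {}xr := le_trans xr e2D; have {}yr := le_trans yr e2D.
have := ler_wpM2l (normr_ge0 (a p)) xr; have := ler_wpM2l (normr_ge0 (b p)) yr.
have : 0 <= e / (2 * D) * `|h| by rewrite mulr_ge0// divr_ge0 ?mulr_ge0// ltW.
have -> : D * (e / (2 * D)) * `|h| = D * (e / (2 * D) * `|h|) by ring.
move: (e / (2 * D) * `|h|) => q.
rewrite /D; lra.
Qed.

Lemma continuous_pair (T : topologicalType) (f g : T -> R) (t : T) :
  {for t, continuous f} -> {for t, continuous g} ->
  {for t, continuous (fun s => (f s, g s))}.
Proof. by move=> cf cg; exact: (cvg_pair (f := f) (g := g) cf cg). Qed.

(* [G + i H] is holomorphic near [p], with derivative [a + i b]. *)
Definition CR_near p G H : Prop := exists a b : R * R -> R,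
  partials_near G a (fun z => - b z) p /\ partials_near H b a p.

Lemma CR_continuous p G H : CR_near p G H -> {for p, continuous G}.
Proof. by move=> [a [b [/partials_continuous]]]. Qed.

Let mu := @lebesgue_measure R.
Let I := `[0, pi *+ 2] : set R.

Let pi2_gt0 : (0 : R) < pi *+ 2. Proof. by rewrite mulrn_wgt0// pi_gt0. Qed.

(** If [f x > 0], then [f] exceeds [f x / 2] on a short interval around [x] inside [[c, d]], and
    this alone makes the integral positive. *)
Lemma Rintegral_continuous_eq0 (f : R -> R) (c d x : R) :
  continuous f -> (forall s, c <= s <= d -> 0 <= f s) ->
  \int[mu]_(s in `[c, d]) f s = 0 -> c < x < d -> f x = 0.
Proof.
move=> cf f0 intf /andP[cx xd].
have integ (s t : R) : mu.-integrable `[s, t] (EFin \o f).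
  apply: continuous_compact_integrable; first exact: segment_compact.
  exact: continuous_subspaceT.
apply/eqP; rewrite eq_le f0 ?(ltW cx) ?(ltW xd)// andbT leNgt; apply/negP => fx.
have fx2 : f x / 2 < f x by lra.
have /nbhs_ballP[r /= r0 fr] : \forall s \near x, f x / 2 < f s.
  exact: (cvgr_gt _ (cf x)).
pose m := Num.min (r / 2) (Num.min (x - c) (d - x)).
have m0 : 0 < m by rewrite !lt_min divr_gt0// !subr_gt0 cx xd.
have [mr mc md] : [/\ m <= r / 2, m <= x - c & m <= d - x].
  by split; rewrite /m !ge_min lexx ?orbT.
have [s1 s1E] : exists s1, s1 = x - m by exists (x - m).
have [e eE] : exists e, e = f x / 2 by exists (f x / 2).
have [s2 s2E] : exists s2, s2 = x + m by exists (x + m).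
have sub : `[s1, s2] `<=` `[c, d].
  by move=> s /=; rewrite !in_itv/= => /andP[]; lra.
have int0 : (\int[mu]_(s in `[c, d]) (EFin \o f) s = 0)%E.
  by rewrite -(fineK (integrable_fin_num _ (integ c d)))//; congr EFin.
have : (\int[mu]_(s in `[s1, s2]) e%:E <= 0)%E.
  rewrite -int0; apply: (@le_trans _ _ (\int[mu]_(s in `[s1, s2]) (EFin \o f) s)%E).
    apply: ge0_le_integral => //.
    - by move=> s _; rewrite lee_fin; lra.
    - exact: (measurable_int mu (integ _ _)).
    - move=> s /=; rewrite in_itv/= => /andP[ss1 ss2]; rewrite lee_fin eE ltW//; apply: fr.
      by rewrite -ball_normE /ball_/= ltr_norml; apply/andP; split; lra.
  apply: ge0_subset_integral => //.
  exact: (measurable_int mu (integ _ _)).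
rewrite integral_cst//= lebesgue_measure_itv/= lte_fin.
have -> : s1 < s2 by lra.
rewrite -EFinB -EFinM lee_fin; apply/negP; rewrite -ltNge mulr_gt0//; lra.
Qed.

(* Negative radii make [r = 0] an interior point of the range of differentiation. *)
Lemma CR_circle_mean p G H : CR_near p G H ->
  exists2 r0 : R, 0 < r0 & forall r : R, `|r| < r0 ->
    continuous (fun t => G (p.1 + r * cos t, p.2 + r * sin t)) /\
    \int[mu]_(t in I) G (p.1 + r * cos t, p.2 + r * sin t) = G p * (pi *+ 2).
Proof.
move=> [a [b [Gab Hab]]].
have bnd (f : R * R -> R) : {for p, continuous f} -> \forall z \near p, `|f z| <= `|f p| + 1.
  move=> /cvgrPdist_lt/(_ 1 ltr01); apply: filterS => z fz.
  rewrite -[X in `|X|](subrK (f p)) (le_trans (ler_normD _ _))// addrC lerD2l.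
  by rewrite distrC ltW.
have [_ _ ca _] := nbhs_singleton Hab.
have [_ _ _ cb] := nbhs_singleton Hab.
have /nearP2[r0 r00 Hr] : \forall z \near p, [/\ partials_near G a (fun z => - b z) z,
    partials_near H b a z, `|a z| <= `|a p| + 1 & `|b z| <= `|b p| + 1].
  near=> z; split; near: z.
  - exact/nbhs_interior/Gab.
  - exact/nbhs_interior/Hab.
  - exact: bnd.
  - exact: bnd.
exists r0 => // r1 r1r.
pose w (r t : R) : R * R := (p.1 + r * cos t, p.2 + r * sin t).
have wr r t : `|r| < r0 -> [/\ partials_near G a (fun z => - b z) (w r t),
   partials_near H b a (w r t), `|a (w r t)| <= `|a p| + 1 & `|b (w r t)| <= `|b p| + 1].
  move=> rr; apply: Hr; rewrite addrC addKr normrM; apply: le_lt_trans rr.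
    by rewrite ler_piMr// ler_norml cos_geN1 cos_le1.
  by rewrite ler_piMr// ler_norml sin_geN1 sin_le1.
(* [k] is the radial derivative of [G]. By the Cauchy-Riemann equations, [r * k r t] is the
   derivative of [H] with respect to the angle. *)
pose k (r t : R) : R := a (w r t) * cos t - b (w r t) * sin t.
have Gr (r t : R) : `|r| < r0 -> is_derive r 1 (fun s => G (w s t)) (k r t).
  move=> /(wr _ t)[Gw _ _ _].
  have dx : is_derive r 1 (fun s => p.1 + s * cos t) (cos t).
    by apply: is_derive_eq; rewrite /GRing.scale/=; ring.
  have dy : is_derive r 1 (fun s => p.2 + s * sin t) (sin t).
    by apply: is_derive_eq; rewrite /GRing.scale/=; ring.
  have := partials_chain (x := fun s => p.1 + s * cos t) (y := fun s => p.2 + s * sin t) Gw dx dy.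
  by move/is_derive_eq; apply; rewrite /k /w /=; ring.
have Ht (r t : R) : `|r| < r0 -> is_derive t 1 (fun s => H (w r s)) (r * k r t).
  move=> /(wr _ t)[_ Hw _ _].
  have dx : is_derive t 1 (fun s => p.1 + r * cos s) (- (r * sin t)).
    by apply: is_derive_eq; rewrite /GRing.scale/=; ring.
  have dy : is_derive t 1 (fun s => p.2 + r * sin s) (r * cos t).
    by apply: is_derive_eq; rewrite /GRing.scale/=; ring.
  have := partials_chain (x := fun s => p.1 + r * cos s) (y := fun s => p.2 + r * sin s) Hw dx dy.
  by move/is_derive_eq; apply; rewrite /k /w /=; ring.
have wc r : continuous (w r).
  move=> t; apply: (continuous_pair (f := fun s => p.1 + r * cos s)
    (g := fun s => p.2 + r * sin s)); apply: cvgD; (try exact: cvg_cst); apply: cvgMr.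
    exact: continuous_cos.
  exact: continuous_sin.
have kc r : `|r| < r0 -> continuous (k r).
  move=> rr t; have [_ /nbhs_singleton[_ _ cb' ca'] _ _] := wr r t rr.
  apply: cvgB; apply: cvgM.
  - exact: (continuous_comp (wc r t) ca').
  - exact: continuous_cos.
  - exact: (continuous_comp (wc r t) cb').
  - exact: continuous_sin.
have fc r : `|r| < r0 -> continuous (fun t => G (w r t)).
  move=> rr t; have [/partials_continuous Gw _ _ _] := wr r t rr.
  exact: (continuous_comp (wc r t) Gw).
split; first exact: fc.
have integ f : continuous f -> mu.-integrable I (EFin \o f).
  move=> cf; apply: continuous_compact_integrable; first exact: segment_compact.
  exact: continuous_subspaceT.
have FTC (f f' : R -> R) : continuous f' -> (forall t : R, is_derive t 1 f (f' t)) ->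
    f (pi *+ 2) = f 0 -> \int[mu]_(t in I) f' t = 0.
  move=> cf' df f2; rewrite /Rintegral.
  rewrite (@continuous_FTC2 _ f' f)//.
  - by rewrite f2 -EFinB subrr.
  - exact: continuous_subspaceT.
  - have cf x : {for x, continuous f} by exact: is_derive_continuous (df x).
    split=> [x _| |]; first exact: ex_derive.
    + by apply: cvg_at_right_filter; exact: cf.
    + by apply: cvg_at_left_filter; exact: cf.
  - by move=> x _; rewrite derive1E derive_val.
(* For [r != 0], [r * k r] is the derivative of a function that returns to its initial value after a
   full turn. At [r = 0], [k] is a combination of sine and cosine with an explicit primitive. *)
have k0 r : `|r| < r0 -> \int[mu]_(t in I) k r t = 0.
  move=> rr; have [->|r0'] := eqVneq r 0.
    apply: (FTC (fun t => a p * sin t + b p * cos t)).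
    - by apply: kc; rewrite normr0.
    - move=> t; apply: is_derive_eq; rewrite /k /w !mul0r !addr0 -surjective_pairing.
      by rewrite /GRing.scale/=; ring.
    - by rewrite sin2pi cos2pi sin0 cos0.
  apply: (mulfI r0'); rewrite mulr0 -RintegralZl//; last 2 first.
  - exact: measurable_itv.
  - exact/integ/kc.
  apply: (FTC (fun t => H (w r t))).
  - by move=> t; apply: cvgMr; exact: kc.
  - by move=> t; exact: Ht.
  - by rewrite /w sin2pi cos2pi sin0 cos0.
(* Differentiation under the integral shows that the integral over the circle has derivative zero in
   [r]; it therefore equals its value at [r = 0]. *)
pose F (r : R) := \int[mu]_(t in I) G (w r t).
have dF (r : R) : `|r| < r0 -> is_derive r 1 F 0.
  move=> rr.
  have Ir : `](- r0), r0[ r by rewrite /= in_itv/= -ltr_norml.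
  have intf x : `](- r0), r0[ x -> mu.-integrable I (EFin \o (fun t => G (w x t))).
    by rewrite /= in_itv/= -ltr_norml => xr; exact/integ/fc.
  have derf x t : `](- r0), r0[ x -> I t -> derivable (fun s => G (w s t)) x 1.
    by rewrite /= in_itv/= -ltr_norml => xr _; have := Gr x t xr; move=> [].
  pose C := `|a p| + `|b p| + 2.
  have dE x t : `|x| < r0 -> partial1of2 (fun r' t => G (w r' t)) x t = k x t.
    by move=> xr; have := Gr x t xr => -[]; rewrite partial1of2E.
  have bnd' x t : `](- r0), r0[ x -> I t -> `|partial1of2 (fun r' t => G (w r' t)) x t| <= C.
    rewrite /= in_itv/= -ltr_norml => xr _; rewrite dE//.
    have [_ _ ax bx] := wr x t xr.
    rewrite /k (le_trans (ler_normB _ _))// !normrM.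
    have -> : C = (`|a p| + 1) * 1 + (`|b p| + 1) * 1 by rewrite /C; ring.
    rewrite lerD// ler_pM// ler_norml.
      by rewrite cos_geN1 cos_le1.
    by rewrite sin_geN1 sin_le1.
  have C0 t : 0 <= (cst C : R -> R) t by rewrite /C/= !addr_ge0.
  have intC : mu.-integrable I (EFin \o cst C) by apply: integ => x; exact: cvg_cst.
  have mI : measurable (I : set (measurableTypeR R)) by exact: measurable_itv.
  split.
    exact: (derivable_under_integral (mu := mu) (f := fun r t => G (w r t))
      mI Ir intf derf C0 intC bnd').
  rewrite -derive1E (differentiation_under_integral (mu := mu)
    (f := fun r t => G (w r t)) mI Ir intf derf C0 intC bnd').
  under eq_Rintegral do rewrite dE//.
  exact: k0.
have dF1 (s : R) : `|s - 0| <= `|r1 - 0| -> is_derive s 1 F ((fun=> 0) s).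
  by rewrite !subr0 => sr1; apply: dF; exact: le_lt_trans sr1 r1r.
have [s _] := MVT_is_derive dF1.
rewrite mul0r => /eqP; rewrite subr_eq0 => /eqP Fs.
rewrite -/(w _ _) -/(F r1) Fs /F.
under eq_Rintegral do rewrite /w !mul0r !addr0 -surjective_pairing.
rewrite Rintegral_cst//; last exact: measurable_itv.
congr (_ * _); suff muI : mu I = (pi *+ 2)%:E by exact: (congr1 fine muI).
rewrite [LHS](lebesgue_measure_itv `[0, pi *+ 2]%R)/= lte_fin pi2_gt0.
by rewrite -EFinB subr0.
Unshelve. all: end_near. Qed.

(** The mean of [G >= 0] over each small circle is zero, so [G] vanishes on the circle. Only the
    angle [pi / 2] is retained; negative radii make this cover both vertical directions. *)
Lemma CR_strong_min p G H : CR_near p G H -> (\forall z \near p, 0 <= G z) ->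
  G p = 0 -> \forall t \near (0 : R), G (p.1, p.2 + t) = 0.
Proof.
move=> /CR_circle_mean[r1 r10 mean] /nearP2[r2 r20 G0] Gp.
have r0 : 0 < Num.min r1 r2 by rewrite lt_min r10.
apply/nbhs_ballP; exists (Num.min r1 r2) => //= r.
rewrite -ball_normE /ball_/= sub0r normrN lt_min => /andP[rr1 rr2].
have [cG intG] := mean r rr1.
have pi0 := pi_gt0 R.
have := @Rintegral_continuous_eq0 _ 0 (pi *+ 2) (pi / 2) cG _ _ _.
rewrite cos_pihalf sin_pihalf mulr0 addr0 mulr1; apply.
- move=> s _; apply: G0; rewrite addrC addKr normrM; apply: le_lt_trans rr2.
    by rewrite ler_piMr// ler_norml cos_geN1 cos_le1.
  by rewrite ler_piMr// ler_norml sin_geN1 sin_le1.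
- by rewrite intG Gp mul0r.
- by apply/andP; split; lra.
Qed.

End CauchyRiemann.

(** * Superharmonic functions and minimum principles *)

Section MinimumPrinciple.
Variable R : realType.
Implicit Types (p z : R * R) (F G H a b : R * R -> R).

Lemma partials_nearD F a b G a' b' p : partials_near F a b p ->
  partials_near G a' b' p ->
  partials_near (fun z => F z + G z) (fun z => a z + a' z) (fun z => b z + b' z) p.
Proof.
move=> hF hG; near=> z.
have [F1 F2 ca cb] : [/\ is_derive z.1 1 (fun s => F (s, z.2)) (a z),
  is_derive z.2 1 (fun s => F (z.1, s)) (b z),
  {for z, continuous a} & {for z, continuous b}] by near: z.
have [G1 G2 ca' cb'] : [/\ is_derive z.1 1 (fun s => G (s, z.2)) (a' z),
  is_derive z.2 1 (fun s => G (z.1, s)) (b' z),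
  {for z, continuous a'} & {for z, continuous b'}] by near: z.
split; [exact: is_deriveD|exact: is_deriveD|exact: cvgD|exact: cvgD].
Unshelve. all: end_near. Qed.

Lemma partials_nearZ k F a b p : partials_near F a b p ->
  partials_near (fun z => k * F z) (fun z => k * a z) (fun z => k * b z) p.
Proof.
apply: filterS => z [F1 F2 ca cb].
split; [exact: is_deriveZ|exact: is_deriveZ|exact: cvgMr|exact: cvgMr].
Qed.

Lemma partials_near_eq F a b F' a' b' p : F =1 F' -> a =1 a' -> b =1 b' ->
  partials_near F a b p -> partials_near F' a' b' p.
Proof. by move=> /funext -> /funext -> /funext ->. Qed.

Lemma partials_nearW F a b p :
  (forall z, [/\ is_derive z.1 1 (fun s => F (s, z.2)) (a z),
    is_derive z.2 1 (fun s => F (z.1, s)) (b z),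
    {for z, continuous a} & {for z, continuous b}]) -> partials_near F a b p.
Proof. by move=> h; near=> z; exact: h. Unshelve. all: end_near. Qed.

Lemma CR_nearD G H G' H' p : CR_near p G H -> CR_near p G' H' ->
  CR_near p (fun z => G z + G' z) (fun z => H z + H' z).
Proof.
move=> [a [b [Ga Hb]]] [a' [b' [Ga' Hb']]].
exists (fun z => a z + a' z), (fun z => b z + b' z); split; last exact: partials_nearD.
by apply: partials_near_eq (partials_nearD Ga Ga') => // z; rewrite opprD.
Qed.

Lemma CR_nearZ k G H p : CR_near p G H ->
  CR_near p (fun z => k * G z) (fun z => k * H z).
Proof.
move=> [a [b [Ga Hb]]].
exists (fun z => k * a z), (fun z => k * b z); split; last exact: partials_nearZ.
by apply: partials_near_eq (partials_nearZ k Ga) => // z; rewrite mulrN.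
Qed.

(** These are the real and imaginary parts of a complex polynomial of degree at most two in
    [z.1 + i z.2]. They supply the affine term of Bernoulli's law and the barrier of Hopf's
    lemma. *)
Lemma CR_near_quadratic (A B C D E : R) p :
  CR_near p
    (fun z => A + B * z.1 + C * z.2 + D * (z.1 * z.1 - z.2 * z.2) + E * (z.1 * z.2))
    (fun z => B * z.2 - C * z.1 + D * (2 * z.1 * z.2) - E / 2 * (z.1 * z.1 - z.2 * z.2)).
Proof.
have aff (k l m : R) (z : R * R) : {for z, continuous (fun z : R * R => k + l * z.1 + m * z.2)}.
  apply: cvgD; first apply: cvgD; first exact: cvg_cst.
    by apply: cvgMr; exact: continuous_fst2.
  by apply: cvgMr; exact: continuous_snd2.
exists (fun z => B + (2 * D) * z.1 + E * z.2), (fun z => - C + (- E) * z.1 + (2 * D) * z.2).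
split; apply: partials_nearW => z; split; try exact: aff.
- by rewrite /=; apply: is_derive_eq; rewrite /GRing.scale/=; ring.
- by rewrite /=; apply: is_derive_eq; rewrite /GRing.scale/=; ring.
- have -> : (fun z : R * R => - (- C + - E * z.1 + 2 * D * z.2)) =
     (fun z => C + E * z.1 + (- (2 * D)) * z.2) by apply/funext => w; ring.
  exact: aff.
- by rewrite /=; apply: is_derive_eq; rewrite /GRing.scale/=; field.
- by rewrite /=; apply: is_derive_eq; rewrite /GRing.scale/=; field.
Qed.

Lemma partials_near_translate F a b p (w : R * R) : partials_near F a b (p + w) ->
  partials_near (fun z => F (z + w)) (fun z => a (z + w)) (fun z => b (z + w)) p.
Proof.
have cw (z : R * R) : {for z, continuous (fun z : R * R => z + w)}.
  apply: (continuous_pair (f := fun z : R * R => z.1 + w.1) (g := fun z : R * R => z.2 + w.2)).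
    by apply: cvgD; [exact: continuous_fst2|exact: cst_continuous].
  by apply: cvgD; [exact: continuous_snd2|exact: cst_continuous].
move=> /(cw p) h; apply: (@filterS _ (nbhs p) _ _ _ _ h) => z [F1 F2 ca cb]; split.
- have dw : is_derive z.1 1 (fun s : R => s + w.1) 1.
    by apply: is_derive_eq; rewrite addr0.
  have := is_derive1_comp (f := fun s => F (s, (z + w).2)) (g := fun s => s + w.1) F1 dw.
  by rewrite mulr1.
- have dw : is_derive z.2 1 (fun s : R => s + w.2) 1.
    by apply: is_derive_eq; rewrite addr0.
  have := is_derive1_comp (f := fun s => F ((z + w).1, s)) (g := fun s => s + w.2) F2 dw.
  by rewrite mulr1.
- exact: (continuous_comp (cw z) ca).
- exact: (continuous_comp (cw z) cb).
Qed.

Lemma CR_near_translate G H p w : CR_near (p + w) G H ->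
  CR_near p (fun z => G (z + w)) (fun z => H (z + w)).
Proof.
move=> [a [b [Ga Hb]]]; exists (fun z => a (z + w)), (fun z => b (z + w)).
split; last exact: partials_near_translate Hb.
exact: (partials_near_translate (b := fun z => - b z) Ga).
Qed.

(* A harmonic function touching [F] from above at [p] stands for the mean value
   inequality; such upper bounds are stable under adding harmonic functions. *)
Definition superharmonic_at F p : Prop := exists G H,
  [/\ CR_near p G H, \forall z \near p, F z <= G z & F p = G p].

Lemma CR_superharmonic p G H : CR_near p G H -> superharmonic_at G p.
Proof. by move=> GH; exists G, H; split => //; near=> z. Unshelve. all: end_near. Qed.

Lemma superharmonic_atD F p G H : superharmonic_at F p -> CR_near p G H ->
  superharmonic_at (fun z => F z + G z) p.
Proof.
move=> [G' [H' [GH' FG Fp]]] GH; exists (fun z => G' z + G z), (fun z => H' z + H z).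
split; [exact: CR_nearD| |by rewrite Fp].
by apply: (@filterS _ (nbhs p) _ _ _ _ FG) => z; rewrite lerD2r.
Qed.

Lemma CR_near_cst p (k : R) : CR_near p (fun=> k) (fun=> 0).
Proof.
exists (fun=> 0), (fun=> 0); split; apply: partials_nearW => z; split;
  (try exact: cvg_cst); by apply: is_derive_eq; rewrite ?oppr0.
Qed.

(** The harmonic majorant [G] touching [F] at [p] also has a local minimum there, so it is constant
    on a vertical segment, where [F] is squeezed between [F p] and [G]. *)
Lemma superharmonic_min F p : superharmonic_at F p ->
  (\forall z \near p, F p <= F z) -> \forall t \near (0 : R), F (p.1, p.2 + t) = F p.
Proof.
move=> [G [H [GH FG Fp]]] pmin.
have GH1 := CR_nearD GH (CR_near_cst p (- F p)).
have G0 : \forall z \near p, 0 <= G z - F p.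
  near=> z; rewrite subr_ge0; apply: (@le_trans _ _ (F z)); by near: z.
have Gp : G p - F p = 0 by rewrite Fp subrr.
have Gt := CR_strong_min GH1 G0 Gp.
have pt : (fun t : R => (p.1, p.2 + t)) t @[t --> 0] --> p.
  rewrite [X in _ --> X](_ : p = (p.1, p.2 + 0)); last by rewrite addr0 -surjective_pairing.
  apply: (continuous_pair (f := fun=> p.1) (g := fun t => p.2 + t)); first exact: cvg_cst.
  by apply: cvgD; [exact: cvg_cst|exact: cvg_id].
have FGt := pt _ FG; have pmint := pt _ pmin.
near=> t.
have /eqP : G (p.1, p.2 + t) - F p = 0 by near: t.
rewrite subr_eq0 => /eqP GtE; apply/eqP; rewrite eq_le -{1}GtE.
by apply/andP; split; near: t.
Unshelve. all: end_near. Qed.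

Lemma within_continuousP (A : set (R * R)) F : {within A, continuous F} <->
  forall z, A z -> forall e : R, 0 < e -> \forall w \near z, A w -> `|F w - F z| < e.
Proof.
split=> cF.
  move=> z Az e e0; have := (subspace_continuousP A F).1 cF z Az.
  move=> /cvgrPdist_lt/(_ e e0) h; apply: (@filterS _ (nbhs z) _ _ _ _ h) => w Fw Aw.
  by rewrite distrC; exact: Fw.
apply/(subspace_continuousP A F) => z Az; apply/cvgrPdist_lt => e e0.
apply: (@filterS _ (nbhs z) _ _ _ _ (cF z Az e e0)) => w Fw Aw.
by rewrite distrC; exact: Fw.
Qed.

Lemma closed_ge0 F : continuous F -> closed [set z | 0 <= F z].
Proof.
move=> cF; have := @preimage_closed _ _ F [set x | 0 <= x] _ (@closed_ge R 0).
by apply => z _; exact: cF.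
Qed.

Lemma compact_box (x1 x2 y1 y2 : R) (K : set (R * R)) : closed K ->
  (forall z, K z -> [/\ x1 <= z.1, z.1 <= x2, y1 <= z.2 & z.2 <= y2]) -> compact K.
Proof.
move=> cK Kb; apply: (subclosed_compact cK (B := `[x1, x2] `*` `[y1, y2])).
  by apply: compact_setX; exact: segment_compact.
by move=> z /Kb[z1 z2 z3 z4]; split; rewrite /= in_itv/=; apply/andP.
Qed.

(** Vertical moves suffice for both minimum principles below, because a nonempty compact level set
    has an extreme point in the direction given by the sign of [s]. *)
Lemma compact_not_level (K : set (R * R)) F (m s : R) : s != 0 -> compact K ->
  {within K, continuous F} ->
  (forall p, K p -> F p = m ->
    exists2 t, 0 < t & K (p.1, p.2 + s * t) /\ F (p.1, p.2 + s * t) = m) ->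
  forall p, K p -> F p <> m.
Proof.
move=> s0 cK cF step p Kp Fp.
(* Contradiction at a point of [Z] where [s * z.2] is maximal. *)
pose Z := K `&` [set z | F z = m].
have hK : closed K := compact_closed (@norm_hausdorff _ _) cK.
have cZ : compact Z.
  apply: (subclosed_compact _ cK); last by move=> z [].
  move=> z Zz.
  have Kz : K z by apply: hK => B /Zz[w [[Kw _] Bw]]; exists w.
  split=> //=; apply/eqP; rewrite -subr_eq0 -normr_le0 leNgt; apply/negP => e0.
  have /(within_continuousP K F)/(_ z Kz _ e0)/Zz[w [[Kw Fw] /(_ Kw)]] := cF.
  by rewrite /= distrC (Fw : F w = m) ltxx.
have [] := @compact_EVT_max _ R (fun z : R * R => s * z.2) Z.
- by exists p.
- exact: cZ.
- apply: continuous_subspaceT => z.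
  by apply: cvgMr; exact: continuous_snd2.
move=> c; rewrite inE => -[Kc Fc] cmax.
have [t t0 [Kt Ft]] := step c Kc Fc.
have := cmax (c.1, c.2 + s * t); rewrite inE => /(_ (conj Kt Ft))/=.
rewrite mulrDr gerDl leNgt mulrA -expr2 => /negP; apply.
by rewrite pmulr_rgt0// exprn_even_gt0.
Qed.

(** The boundary of [K] enters only through the hypothesis on negative minima, which has to be
    refuted there in each application. Elsewhere the minimum value propagates upwards, which
    compactness forbids. *)
Lemma minimum_principle (K : set (R * R)) F : compact K -> {within K, continuous F} ->
  (forall p, K p -> F p < 0 -> (forall z, K z -> F p <= F z) ->
    [/\ superharmonic_at F p, \forall z \near p, F p <= F z &
        \forall t \near (0 : R), K (p.1, p.2 + t)]) ->
  forall p, K p -> 0 <= F p.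
Proof.
move=> cK cF inn p Kp; rewrite leNgt; apply/negP => Fp.
have [] := @compact_EVT_min _ _ F K; [by exists p|exact: cK|exact: cF|].
move=> c; rewrite inE => Kc cmin.
have {}cmin z : K z -> F c <= F z by move=> Kz; apply: cmin; rewrite inE.
have Fc : F c < 0 by apply: le_lt_trans Fp; exact: cmin.
apply: (@compact_not_level K F (F c) 1 _ cK cF _ c Kc) => // q Kq Fq.
have [||Fs qmin Kt] := inn q Kq; [by rewrite Fq|by move=> z; rewrite Fq; exact: cmin|].
have /nbhs_ballP[r /= r0] : \forall t \near (0 : R), K (q.1, q.2 + t) /\ F (q.1, q.2 + t) = F q.
  exact: filterI Kt (superharmonic_min Fs qmin).
rewrite -ball_normE => /(_ (r / 2)); rewrite /ball_/= sub0r normrN gtr0_norm ?divr_gt0//.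
have r2 : r / 2 < r by lra.
move=> /(_ r2)[Kr Fr]; exists (r / 2); first by rewrite divr_gt0.
by rewrite mul1r Fr.
Qed.

(** A zero at [(x, y)] would propagate along the vertical segment to its end, where [F] is positive.
    Such segments are enough because the fluid lies under a graph: [s = -1] leads down to great
    depth, [s = 1] up to the surface. *)
Lemma strong_minimum_principle F (x y h s : R) : 0 < h -> s != 0 ->
  {within [set z : R * R | z.1 = x /\ exists2 t, 0 <= t <= h & z.2 = y + s * t], continuous F} ->
  (forall t, 0 <= t < h -> superharmonic_at F (x, y + s * t) /\
     \forall z \near (x, y + s * t), 0 <= F z) ->
  0 < F (x, y + s * h) -> 0 < F (x, y).
Proof.
move=> h0 s0 cF FS Fh.
pose K := [set z : R * R | z.1 = x /\ exists2 t, 0 <= t <= h & z.2 = y + s * t].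
have KE : K = (fun t => (x, y + s * t)) @` `[0, h].
  apply/seteqP; split => [[z1 z2] [/= -> [t th ->]]|z [t]]; first by exists t; rewrite //= in_itv.
  by rewrite /= in_itv/= => th <-; split => //; exists t.
have cK : compact K.
  rewrite KE; apply: continuous_compact; last exact: segment_compact.
  apply: continuous_subspaceT => t.
  apply: (continuous_pair (f := fun=> x) (g := fun t => y + s * t)); first exact: cvg_cst.
  by apply: cvgD; [exact: cvg_cst|apply: cvgMr; exact: cvg_id].
have K0 : K (x, y) by split => //; exists 0; rewrite ?lexx ?ltW//= mulr0 addr0.
have F0 : 0 <= F (x, y).
  have [|_ /nbhs_singleton] := FS 0; first by rewrite lexx.
  by rewrite mulr0 addr0.
rewrite lt_def F0 andbT; apply/eqP.
apply: (@compact_not_level K F 0 s s0 cK cF _ (x, y) K0) => -[_ _] [/= -> [t th ->]] Ft.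
have {}th : 0 <= t < h.
  move: th => /andP[t0 th]; rewrite t0/= lt_neqAle th andbT; apply/eqP => tE.
  by move: Fh; rewrite -tE Ft ltxx.
have [Fs Fpos] := FS t th.
have {}Ft : F (x, y + s * t) = 0 := Ft.
have Fmin : \forall z \near (x, y + s * t), F (x, y + s * t) <= F z by rewrite Ft.
have /nbhs_ballP[r /= r0] : \forall u \near (0 : R), F (x, y + s * t + u) = F (x, y + s * t).
  exact: superharmonic_min Fs Fmin.
rewrite -ball_normE /ball_/= => Fr.
move: th => /andP[t0 th].
(* Small enough for [s * d] to stay within the radius [r], and for [t + d] not to pass the end
   [h]. *)
pose d := Num.min (r / (2 * `|s|)) (h - t).
have d0 : 0 < d by rewrite lt_min subr_gt0 th divr_gt0// mulr_gt0// normr_gt0.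
exists d => //; split.
  split => //; exists (t + d); last by rewrite /=; ring.
  by rewrite addr_ge0 ?(ltW d0)//= -lerBrDl /d ge_min lexx orbT.
rewrite -Ft; apply: Fr; rewrite /= sub0r normrN normrM [`|d|]gtr0_norm//.
rewrite mulrC -ltr_pdivlMr ?normr_gt0//.
apply: (@le_lt_trans _ _ (r / (2 * `|s|))); first by rewrite /d ge_min lexx.
by rewrite ltr_pM2l// ltf_pV2 ?posrE ?mulr_gt0 ?normr_gt0// ltr_pMl ?normr_gt0// ltr1n.
Qed.

End MinimumPrinciple.

(** * Hopf's boundary point lemma *)

Section BoundaryPoint.
Variable R : realType.
Implicit Types (p z : R * R) (F G H a b : R * R -> R).

Lemma near_gt (T : topologicalType) (f : T -> R) (x : T) (k : R) :
  {for x, continuous f} -> k < f x -> \forall t \near x, k < f t.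
Proof. by move=> cf; exact: (cvgr_gt _ cf). Qed.

Lemma near_lt (T : topologicalType) (f : T -> R) (x : T) (k : R) :
  {for x, continuous f} -> f x < k -> \forall t \near x, f t < k.
Proof. by move=> cf; exact: (cvgr_lt _ cf). Qed.

Lemma compact_lower_bound (K : set (R * R)) F : compact K -> {within K, continuous F} ->
  (forall z, K z -> 0 < F z) -> exists2 d : R, 0 < d & forall z, K z -> d <= F z.
Proof.
move=> cK cF F0; have [K0|/set0P/negP/negPn/eqP ->] := pselect (K !=set0); last by exists 1.
have [c] := @compact_EVT_min _ _ F K K0 cK cF.
rewrite inE => Kc cmin; exists (F c); first exact: F0.
by move=> z Kz; apply: cmin; rewrite inE.
Qed.

(** With [(m, n)] an inner normal, of any length, of a half-plane whose edge passes through [p],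
    this is the normal coordinate up to a factor; [linear_form p (- n) m] is the tangential one. *)
Definition linear_form p (m n : R) (z : R * R) : R := m * (z.1 - p.1) + n * (z.2 - p.2).

Definition half_box p (m n r : R) : set (R * R) :=
  [set z | [/\ `|z.1 - p.1| <= r, `|z.2 - p.2| <= r & 0 <= linear_form p m n z]].

(* With [N] and [T] the coordinates normal and tangential to the edge of the
   half-plane, this is [Re (s + s^2)] at [s = N + i T]. *)
Definition barrier p (m n : R) (z : R * R) : R :=
  linear_form p m n z + linear_form p m n z ^+ 2 - linear_form p (- n) m z ^+ 2.

Lemma CR_near_barrier p m n z : exists H, CR_near z (barrier p m n) H.
Proof.
have := CR_near_quadratic 0 m n (m ^+ 2 - n ^+ 2) (4 * m * n) (z + (- p)).
move=> /CR_near_translate [a [b [Ga Hb]]].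
eexists; exists a, b; split; last exact: Hb.
apply: partials_near_eq Ga => // w.
by rewrite /barrier /linear_form /=; ring.
Qed.

Lemma continuous_linear_form p m n : continuous (linear_form p m n).
Proof.
move=> z; apply: cvgD; apply: cvgMr; apply: cvgB; try exact: cst_continuous.
  exact: continuous_fst2.
exact: continuous_snd2.
Qed.

Lemma continuous_barrier p m n : continuous (barrier p m n).
Proof. by move=> z; have [H /CR_continuous] := CR_near_barrier p m n z. Qed.

Lemma closed_half_box p m n r : closed (half_box p m n r).
Proof.
have -> : half_box p m n r =
    [set z | 0 <= r - `|z.1 - p.1|] `&` [set z | 0 <= r - `|z.2 - p.2|] `&`
    [set z | 0 <= linear_form p m n z].
  by apply/seteqP; split=> z; rewrite /half_box/= !subr_ge0; [case|case; case].
apply: closedI; first apply: closedI; apply: closed_ge0.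
- move=> z; apply: cvgB; first exact: cst_continuous.
  apply: cvg_norm; apply: cvgB; last exact: cst_continuous.
  exact: continuous_fst2.
- move=> z; apply: cvgB; first exact: cst_continuous.
  apply: cvg_norm; apply: cvgB; last exact: cst_continuous.
  exact: continuous_snd2.
- exact: continuous_linear_form.
Qed.

(** Where the barrier is negative the bound is immediate. The remaining set [W] meets the edge only
    at [p], so [F] has a positive lower bound on the part of [W] on the sides of the box; the
    minimum principle then keeps [F] above a small multiple of the barrier. *)
Lemma hopf F p (m n r : R) : m != 0 -> 0 < r ->
  {within half_box p m n r, continuous F} ->
  (forall z, half_box p m n r z -> 0 <= F z) ->
  (forall z, half_box p m n r z -> 0 < linear_form p m n z -> 0 < F z) ->
  (forall z, `|z.1 - p.1| < r -> `|z.2 - p.2| < r -> 0 < linear_form p m n z ->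
    superharmonic_at F z) ->
  exists2 e : R, 0 < e & forall z, half_box p m n r z -> e * barrier p m n z <= F z.
Proof.
move=> m0 r0 cF F0 Fpos Fs.
set W0 := half_box p m n r; set q := barrier p m n; set N := linear_form p m n.
have cq : continuous q by exact: continuous_barrier.
pose W := W0 `&` [set z | 0 <= q z].
have cW : compact W.
  apply: (@compact_box R (p.1 - r) (p.1 + r) (p.2 - r) (p.2 + r)).
    by apply: closedI; [exact: closed_half_box|exact: closed_ge0].
  move=> z [[]]; rewrite !ler_norml => /andP[? ?] /andP[? ?] _ _.
  by split; lra.
(* On the edge the barrier is minus the square of the tangential coordinate, hence nonnegative only
   at [p]. *)
have NT z : W0 z -> 0 <= q z -> ~ (0 < N z) -> z = p.
  move=> [_ _ Nz] qz /negP; rewrite -leNgt => N0.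
  have {N0}N0 : linear_form p m n z = 0 by apply/eqP; rewrite eq_le N0.
  have : linear_form p (- n) m z ^+ 2 <= 0.
    by move: qz; rewrite /q /barrier N0 expr0n/= addr0 sub0r oppr_ge0.
  move=> T0; have {T0}/eqP : linear_form p (- n) m z ^+ 2 = 0.
    by apply/eqP; rewrite eq_le T0 sqr_ge0.
  rewrite expf_eq0/= => /eqP.
  move: N0; rewrite /linear_form => e1 e2.
  have mn : m ^+ 2 + n ^+ 2 != 0.
    by rewrite gt_eqF// ltr_pwDl ?sqr_ge0// exprn_even_gt0.
  have e3 : (m ^+ 2 + n ^+ 2) * (z.1 - p.1) = 0.
    by rewrite -(mulr0 m) -[in RHS]e1 -[RHS]subr0 -(mulr0 n) -[in RHS]e2; ring.
  have e4 : (m ^+ 2 + n ^+ 2) * (z.2 - p.2) = 0.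
    by rewrite -(mulr0 n) -[in RHS]e1 -[RHS]addr0 -(mulr0 m) -[in RHS]e2; ring.
  move/eqP : e3; rewrite mulf_eq0 (negPf mn)/= subr_eq0 => /eqP e3.
  move/eqP : e4; rewrite mulf_eq0 (negPf mn)/= subr_eq0 => /eqP e4.
  by rewrite [z]surjective_pairing e3 e4 -surjective_pairing.
(* The part of [W] on the sides of the box. It avoids [p], the centre of the box. *)
pose C := W `&` [set z | 0 <= Num.max `|z.1 - p.1| `|z.2 - p.2| - r].
have cC : compact C.
  apply: (subclosed_compact _ cW); last by move=> z [].
  apply: closedI; first exact: compact_closed (@norm_hausdorff _ _) cW.
  apply: closed_ge0 => z; apply: cvgB; last exact: cst_continuous.
  apply: (continuous_max (f := fun z : R * R => `|z.1 - p.1|)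
    (g := fun z : R * R => `|z.2 - p.2|)); apply: cvg_norm; apply: cvgB; try exact: cst_continuous.
    exact: continuous_fst2.
  exact: continuous_snd2.
have cFW : {within W, continuous F} by apply: continuous_subspaceW cF => z [].
have [d d0 dF] : exists2 d : R, 0 < d & forall z, C z -> d <= F z.
  apply: compact_lower_bound => //.
    by apply: continuous_subspaceW cFW => z [].
  move=> z [[Wz qz] /= zr]; apply: Fpos => //.
  apply: contrapT => Nz; move: zr; rewrite (NT z)// !subrr normr0 maxxx sub0r.
  by rewrite oppr_ge0 leNgt r0.
(* [s] bounds the normal coordinate on the box, so that [B] bounds the barrier and
   [d / B * q z <= d]. *)
pose s := (`|m| + `|n|) * r.
have s0 : 0 <= s by rewrite mulr_ge0 ?addr_ge0// ltW.
have qs z : W0 z -> q z <= 1 + s + s ^+ 2.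
  move=> [z1 z2 Nz].
  have Ns : linear_form p m n z <= s.
    apply: (le_trans (ler_norm _)); rewrite (le_trans (ler_normD _ _))// !normrM.
    by rewrite /s mulrDl lerD// ler_wpM2l.
  rewrite /q /barrier lerBlDr; apply: (@le_trans _ _ (s + s ^+ 2)).
    by rewrite lerD// lerXn2r ?nnegrE.
  by have := sqr_ge0 (linear_form p (- n) m z); lra.
pose B := 1 + s + s ^+ 2.
have B0 : 0 < B by have := sqr_ge0 s; rewrite /B; lra.
exists (d / B); first by rewrite divr_gt0.
move=> z Wz; have [qz|qz] := leP 0 (q z); last first.
  apply: le_trans (F0 _ Wz); rewrite pmulr_rle0 ?divr_gt0//.
  exact: ltW.
rewrite -subr_ge0.
apply: (@minimum_principle R W (fun z => F z - d / B * q z)) => //.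
  apply/within_continuousP => w Ww e e0.
  have e20 : 0 < e / 2 by rewrite divr_gt0.
  have h1 := (within_continuousP W F).1 cFW w Ww _ e20.
  have cq' : {for w, continuous (fun z => d / B * q z)} by apply: cvgMr; exact: cq.
  have h2 : \forall t \near w, `|d / B * q w - d / B * q t| < e / 2.
    by move/cvgrPdist_lt : cq'; apply.
  near=> t.
  have : W t -> `|F t - F w| < e / 2 by near: t.
  have : `|d / B * q w - d / B * q t| < e / 2 by near: t.
  move=> Hq HF /HF {}HF.
  have -> : F t - d / B * q t - (F w - d / B * q w) =
    (F t - F w) + (d / B * q w - d / B * q t) by ring.
  by rewrite (le_lt_trans (ler_normD _ _))//; lra.
move=> w [Ww qw] Fw wmin.
(* A negative minimum is interior to [W]: on the sides of the box [F >= d >= d / B * q w], while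
   [F >= 0] forces [q w > 0] and thereby a positive normal coordinate. *)
have zr : Num.max `|w.1 - p.1| `|w.2 - p.2| < r.
  rewrite ltNge; apply/negP => wr.
  have : d <= F w by apply: dF; split => //=; rewrite subr_ge0.
  apply/negP; rewrite -ltNge.
  apply: (@lt_le_trans _ _ (d / B * q w)); first by rewrite -subr_lt0.
  by rewrite mulrAC ler_pdivrMr// ler_pM2l//; exact: qs.
move: zr; rewrite gt_max => /andP[w1 w2].
have q0 : 0 < q w.
  rewrite -(pmulr_rgt0 _ (divr_gt0 d0 B0)); apply: le_lt_trans (F0 _ Ww) _.
  by rewrite -subr_lt0.
have Nw : 0 < N w.
  apply: contrapT => Nw; move: q0; rewrite (NT w)// /q /barrier /linear_form.
  by rewrite !subrr !mulr0 !addr0 expr0n/= addr0 subrr ltxx.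
have near_W : \forall t \near w, W t.
  have k1 : \forall t \near w, `|t.1 - p.1| < r.
    apply: (near_lt (f := fun t : R * R => `|t.1 - p.1|)) => //.
    by apply: cvg_norm; apply: cvgB; [exact: continuous_fst2|exact: cst_continuous].
  have k2 : \forall t \near w, `|t.2 - p.2| < r.
    apply: (near_lt (f := fun t : R * R => `|t.2 - p.2|)) => //.
    by apply: cvg_norm; apply: cvgB; [exact: continuous_snd2|exact: cst_continuous].
  have k3 : \forall t \near w, 0 < N t.
    by apply: near_gt => //; exact: continuous_linear_form.
  have k4 : \forall t \near w, 0 < q t.
    by apply: near_gt => //; exact: cq.
  near=> t; split; last by apply/ltW; near: t.
  by split; apply/ltW; near: t.
have [H qH] := CR_near_barrier p m n w.
split.
- have := superharmonic_atD (Fs w w1 w2 Nw) (CR_nearZ (- (d / B)) qH).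
  by congr (superharmonic_at _ _); apply/funext => t; rewrite mulNr.
- by near=> t; apply: wmin; near: t.
- have wt : (fun t : R => (w.1, w.2 + t)) t @[t --> 0] --> w.
    rewrite [X in _ --> X](_ : w = (w.1, w.2 + 0)); last by rewrite addr0 -surjective_pairing.
    apply: (continuous_pair (f := fun=> w.1) (g := fun t => w.2 + t)); first exact: cst_continuous.
    by apply: cvgD; [exact: cst_continuous|exact: cvg_id].
  exact: wt _ near_W.
Unshelve. all: end_near. Qed.

End BoundaryPoint.

(** * Shape of the free surface *)

Section WaveGeometry.
Variables (R : realType) (g c patm : R) (eta : R -> R) (u v P : R * R -> R).
Hypothesis hw : extreme_stokes_wave g c patm eta u v P.
Let hs := esw_stokes hw.
Let pi2E : (pi *+ 2 : R) = 2 * pi. Proof. by rewrite mulr_natl. Qed.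

Lemma eta_convex (a b t : R) : 0 <= a <= 2 * pi -> 0 <= b <= 2 * pi -> 0 <= t <= 1 ->
  eta (t * a + (1 - t) * b) <= t * eta a + (1 - t) * eta b.
Proof.
move=> ha hb /andP[t0 t1].
have := esw_convex hw (Itv01 t0 t1) (x := a) (y := b).
rewrite !inE/= !in_itv/= pi2E => /(_ ha hb).
by rewrite !convRE.
Qed.

Lemma eta_sym (x : R) : eta (2 * pi - x) = eta x.
Proof. by rewrite addrC -pi2E (sw_eta_periodic hs) (sw_eta_even hs). Qed.

(** [x] is a convex combination of [s] and its mirror image [2 * pi - s], where [eta] takes the same
    value. *)
Lemma eta_chord (s x : R) : 0 <= s -> s <= x -> x <= 2 * pi - s -> eta x <= eta s.
Proof.
move=> s0 sx xs.
have [sE|sE] := eqVneq s pi; first by have -> : x = s by lra.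
have s_lt : s < pi by rewrite lt_neqAle sE; lra.
pose t := (2 * pi - s - x) / (2 * (pi - s)).
have d0 : 0 < 2 * (pi - s) by lra.
have t01 : 0 <= t <= 1.
  by rewrite /t divr_ge0 ?(ltW d0)//=; [rewrite ler_pdivrMr//; lra|lra].
have xE : x = t * s + (1 - t) * (2 * pi - s).
  by rewrite /t; field; lra.
rewrite xE (le_trans (eta_convex _ _ t01))//; try by apply/andP; split; lra.
by rewrite eta_sym -mulrDl addrC subrK mul1r.
Qed.

Lemma crest_abscissa_inside (x : R) : 0 < x < 2 * pi -> ~ crest_abscissa x.
Proof.
move=> /andP[x0 x2] [m xE].
have p20 : 0 < 2 * pi :> R by lra.
move: x0 x2; rewrite xE pi2E pmulr_lgt0// ltr0z => m0.
rewrite gtr_pMl// -[1]/(1%:~R) ltr_int.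
by lia.
Qed.

(** If [eta s <= eta x], then [eta_chord] makes [x] a local maximum, hence a crest strictly between
    two successive crests. *)
Lemma eta_lt (s x : R) : 0 <= s -> s < x -> x < 2 * pi - s -> eta x < eta s.
Proof.
move=> s0 sx xs; rewrite ltNge; apply/negP => sx_le.
apply: (@crest_abscissa_inside x); first by apply/andP; split; lra.
apply/(sw_crests hs); rewrite /local_max.
have h1 : \forall y \near x, s < y.
  by apply: (near_gt (f := fun y => y)) => //; exact: cvg_id.
have h2 : \forall y \near x, y < 2 * pi - s.
  by apply: (near_lt (f := fun y => y)) => //; exact: cvg_id.
near=> y; apply: le_trans sx_le; apply: eta_chord => //.
  by apply: ltW; near: y.
by apply: ltW; near: y.
Unshelve. all: end_near. Qed.

Lemma eta_lt0 (x : R) : 0 < x < 2 * pi -> eta x < eta 0.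
Proof. by move=> /andP[x0 x2]; apply: eta_lt => //; rewrite subr0. Qed.

(** [x - 2 * x0] is the opposite of the mirror image of [x] in the line at [x0]. It is closer to the
    crest at 0 than [x] is to the crests at 0 and [2 * pi], so the surface is higher there. *)
Lemma eta_translate_lt (x0 x : R) : 0 < x0 < pi -> x0 < x < x0 + pi ->
  eta x < eta (x - 2 * x0).
Proof.
move=> /andP[x00 x0p] /andP[xx0 xx0p].
have -> : eta (x - 2 * x0) = eta `|x - 2 * x0|.
  by have [h|h] := ger0P (x - 2 * x0); rewrite ?(sw_eta_even hs).
apply: eta_lt => //; have [h|h] := ger0P (x - 2 * x0); lra.
Qed.

Lemma eta_translate_le (x0 x : R) : 0 < x0 < pi -> x0 <= x <= x0 + pi ->
  eta x <= eta (x - 2 * x0).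
Proof.
move=> x0p /andP[]; rewrite le_eqVlt => /predU1P[<- _|xx0].
  have -> : x0 - 2 * x0 = - x0 by ring.
  by rewrite (sw_eta_even hs).
rewrite le_eqVlt => /predU1P[->|xx0p]; last by rewrite ltW// eta_translate_lt ?xx0.
have -> : x0 + pi - 2 * x0 = 2 * pi - (x0 + pi) by ring.
by rewrite eta_sym.
Qed.

Lemma closure_fluid (z : R * R) : z.2 <= eta z.1 -> closure (fluid eta) z.
Proof.
move=> zeta B /nbhs_ballP[r /= r0 Br].
exists (z.1, z.2 - r / 2); split; first by rewrite /fluid/=; lra.
apply: Br; split; rewrite -ball_normE /ball_/=; first by rewrite subrr normr0.
by rewrite subKr gtr0_norm; lra.
Qed.

Lemma fluid_closure (z : R * R) : fluid eta z -> closure (fluid eta) z.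
Proof. exact: subset_closure. Qed.

Lemma continuous_depth : continuous (fun z : R * R => eta z.1 - z.2).
Proof.
move=> z; apply: cvgB; last exact: continuous_snd2.
exact: (continuous_comp (continuous_fst2 (x := z)) (sw_eta_continuous hs (x := z.1))).
Qed.

Lemma closure_fluid_le (z : R * R) : closure (fluid eta) z -> z.2 <= eta z.1.
Proof.
move=> cz; rewrite -subr_ge0.
apply: (closed_ge0 continuous_depth) => B /cz[w [fw Bw]]; exists w; split => //.
by rewrite /= subr_ge0 ltW.
Qed.

Lemma near_fluid (z : R * R) : fluid eta z -> \forall w \near z, fluid eta w.
Proof.
rewrite /fluid/= => zeta.
have : \forall w \near z, 0 < eta w.1 - w.2.
  by apply: near_gt; [exact: continuous_depth|rewrite subr_gt0].
by move=> h; apply: (@filterS _ (nbhs z) _ _ _ _ h) => w; rewrite subr_gt0.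
Qed.

(** Brings every point back into one period, so that the pressure can be minimised over a compact
    set; [k] counts the periods to remove. *)
Lemma periodic_strip (x : R) : exists2 x' : R, 0 <= x' <= 2 * pi &
  eta x' = eta x /\ forall y, y <= eta x -> P (x', y) = P (x, y).
Proof.
have shift (n : nat) x' : eta (x' + n%:R * (2 * pi)) = eta x' /\
    forall y, y <= eta x' -> P (x' + n%:R * (2 * pi), y) = P (x', y).
  elim: n => [|n [IHe IHP]]; first by rewrite mul0r addr0.
  have -> : x' + n.+1%:R * (2 * pi) = x' + n%:R * (2 * pi) + pi *+ 2.
    by rewrite pi2E -natr1; ring.
  rewrite (sw_eta_periodic hs) IHe; split => // y yx.
  by rewrite (sw_P_periodic hs) ?IHP//; apply: closure_fluid; rewrite IHe.
pose k := Num.floor (x / (2 * pi)).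
have p20 : 0 < 2 * pi :> R by rewrite mulr_gt0// pi_gt0.
have kx : k%:~R * (2 * pi) <= x.
  by rewrite -ler_pdivlMr//; exact: floor_le.
have xk : x <= (k + 1)%:~R * (2 * pi).
  by rewrite -ler_pdivrMr//; apply: ltW; exact: floorD1_gt.
exists (x - k%:~R * (2 * pi)).
  rewrite subr_ge0 kx/= lerBlDr; move: xk; rewrite intrD mulrDl mul1r addrC//.
case: k kx xk => n _ _.
  have [e1 e2] := shift n (x - n%:~R * (2 * pi)).
  move: e1 e2; rewrite subrK => e1 e2; rewrite -e1; split => // y yx.
  by rewrite e2// -e1.
have [e1 e2] := shift n.+1 x.
by rewrite NegzE intrN mulNr opprK.
Qed.

End WaveGeometry.

(** * Bernoulli's law and lower bounds for the pressure *)

Section Pressure.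
Variables (R : realType) (g c patm : R) (eta : R -> R) (u v P : R * R -> R).
Hypothesis hw : extreme_stokes_wave g c patm eta u v P.
Let hs := esw_stokes hw.
Let g0 : 0 < g := sw_gravity hs.
Let c0 : 0 < c := sw_speed hs.

Lemma C1_is_derive (D : set (R * R)) (f : R * R -> R) (z : R * R) : C1_on D f -> D z ->
  [/\ is_derive z.1 1 (fun s => f (s, z.2)) (dx f z),
    is_derive z.2 1 (fun s => f (z.1, s)) (dy f z),
    {for z, continuous (dx f)} & {for z, continuous (dy f)}].
Proof.
move=> f1 /f1[d1 d2 cx cy]; split; [..|exact: cx|exact: cy].
  by apply: DeriveDef d1 _; rewrite /dx derive1E.
by apply: DeriveDef d2 _; rewrite /dy derive1E.
Qed.

Lemma fluid_nearW (z : R * R) (Q : set (R * R)) : fluid eta z ->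
  (forall w, fluid eta w -> Q w) -> \forall w \near z, Q w.
Proof.
by move=> fz FQ; have h := near_fluid hw fz; apply: (@filterS _ (nbhs z) _ _ _ _ h).
Qed.

Lemma fluid_partials (f : R * R -> R) (z : R * R) :
  C1_on (fluid eta) f -> fluid eta z -> partials_near f (dx f) (dy f) z.
Proof. by move=> f1 fz; apply: (fluid_nearW fz) => w fw; exact: C1_is_derive f1 fw. Qed.

Let u1 : C1_on (fluid eta) u. Proof. by case: (sw_u_C1 hs). Qed.
Let v1 : C1_on (fluid eta) v. Proof. by case: (sw_v_C1 hs). Qed.
Let P1 : C1_on (fluid eta) P. Proof. by case: (sw_P_C1 hs). Qed.

Lemma mass_dy (z : R * R) : fluid eta z -> dy v z = - dx u z.
Proof. by move=> /(sw_mass hs)/eqP; rewrite addrC addr_eq0 => /eqP. Qed.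

Lemma irrotational_dx (z : R * R) : fluid eta z -> dx v z = dy u z.
Proof. by move=> /(sw_irrotational hs)/eqP; rewrite subr_eq0 => /eqP. Qed.

(** Incompressibility and irrotationality are the Cauchy-Riemann equations of [u - i v].
    Multiplication by [i] gives the pair of [CR_near_v]. *)
Lemma CR_near_u (z : R * R) : fluid eta z -> CR_near z u (fun w => - v w).
Proof.
move=> fz; exists (dx u), (fun w => - dy u w); split.
  by apply: partials_near_eq (fluid_partials u1 fz) => // w; rewrite opprK.
apply: (fluid_nearW fz) => w fw.
have [d1 d2 _ _] := C1_is_derive v1 fw; have [_ _ cux cuy] := C1_is_derive u1 fw.
rewrite -(irrotational_dx fw) -[dx u w]opprK -(mass_dy fw).
split; [exact: (is_deriveN d1)|exact: (is_deriveN d2)|exact: cvgN|exact: cux].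
Qed.

Lemma CR_near_v (z : R * R) : fluid eta z -> CR_near z v u.
Proof.
move=> fz; exists (dx v), (fun w => - dy v w); split.
  by apply: partials_near_eq (fluid_partials v1 fz) => // w; rewrite opprK.
apply: (fluid_nearW fz) => w fw.
have [d1 d2 _ _] := C1_is_derive u1 fw; have [_ _ cvx cvy] := C1_is_derive v1 fw.
rewrite (irrotational_dx fw) (mass_dy fw) opprK.
split; [exact: d1|exact: d2|exact: cvgN|exact: cvx].
Qed.

Lemma closure_cvg (f : R * R -> R) (z : R * R) :
  {within closure (fluid eta), continuous f} -> closure (fluid eta) z ->
  f w @[w --> within (closure (fluid eta)) (nbhs z)] --> f z.
Proof. by move=> cf cz; exact: (subspace_continuousP _ _).1 cf z cz. Qed.

Definition sqspeed (z : R * R) : R := (u z - c) ^+ 2 + v z ^+ 2.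

Let cu : {within closure (fluid eta), continuous u}. Proof. by case: (sw_u_C1 hs). Qed.
Let cv : {within closure (fluid eta), continuous v}. Proof. by case: (sw_v_C1 hs). Qed.
Let cP : {within closure (fluid eta), continuous P}. Proof. by case: (sw_P_C1 hs). Qed.

Lemma sqspeed_cvg (z : R * R) : closure (fluid eta) z ->
  sqspeed w @[w --> within (closure (fluid eta)) (nbhs z)] --> sqspeed z.
Proof.
move=> cz; apply: cvgD; rewrite expr2; under eq_fun do rewrite expr2.
  by apply: cvgM; apply: cvgB; (try exact: cvg_cst); exact: closure_cvg.
by apply: cvgM; exact: closure_cvg.
Qed.

(** At such depths a horizontal segment joins the vertical line at [x] to the crest-line inside the
    fluid, and the velocity is small. *)
Lemma deep_point (x y : R) : exists2 h, 0 < h & forall t, h <= t ->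
  (forall s, `|s| <= `|x| -> fluid eta (s, y - t)) /\
  `|u (x, y - t)| < c /\ `|v (x, y - t)| < c.
Proof.
have ceta : {within `[- `|x|, `|x|], continuous eta}.
  by apply: continuous_subspaceT => s; exact: sw_eta_continuous hs _.
have xx : - `|x| <= `|x| by have := normr_ge0 x; lra.
have [s _ smin] := EVT_min xx ceta.
have [M [_ MP]] := sw_depth hs c0.
(* The three terms ensure that [h] is positive, that [y - h] is below the minimum of [eta] on
   [[- |x|, |x|]], and that it is below the level [M] where the velocity components are less than
   [c]. *)
pose h := Num.max 1 (Num.max (y - eta s + 1) (y - M + 1)).
have [h1 h2 h3] : [/\ 1 <= h, y - eta s + 1 <= h & y - M + 1 <= h].
  by split; rewrite /h !le_max lexx ?orbT.
exists h; first lra.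
move=> t ht.
have fl s' : `|s'| <= `|x| -> fluid eta (s', y - t).
  rewrite ler_norml => s'x; rewrite /fluid/=.
  by have := smin s'; rewrite in_itv/= => /(_ s'x); lra.
split => //; apply: MP; last exact: fl.
by lra.
Qed.

(** [c - u] is harmonic and nonnegative in the fluid, and positive far down; the strong minimum
    principle applies along a descending segment. *)
Lemma speed_lt (z : R * R) : fluid eta z -> u z < c.
Proof.
case: z => x y fz.
have [h h0 deep] := deep_point x y.
have [fh [uh _]] := deep h (lexx h).
have fs t : 0 <= t <= h -> fluid eta (x, y + (-1) * t).
  by move: fz; rewrite /fluid/= => fz /andP[t0 _]; lra.
have CRF (t : R) : 0 <= t <= h -> CR_near (x, y + (-1) * t) (fun z => c - u z) (fun z => v z).
  move=> ht; have := CR_nearD (CR_near_cst _ c) (CR_nearZ (-1) (CR_near_u (fs t ht))).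
  move=> [a [b [Ga Hb]]]; exists a, b; split.
    by apply: partials_near_eq Ga => // w; rewrite mulN1r.
  by apply: partials_near_eq Hb => // w; rewrite mulN1r opprK add0r.
suff : 0 < c - u (x, y) by rewrite subr_gt0.
apply: (@strong_minimum_principle R (fun z => c - u z) x y h (-1)) => //.
- apply/within_continuousP => w [w1 [t ht w2]] e e0.
  have cw := CR_continuous (CRF t ht).
  have -> : w = (x, y + (-1) * t) by rewrite -w1 -w2 -surjective_pairing.
  have h1 : \forall z \near (x, y + (-1) * t), `|c - u (x, y + (-1) * t) - (c - u z)| < e.
    by move/cvgrPdist_lt : cw; apply.
  by apply: (@filterS _ (nbhs _) _ _ _ _ h1) => z; rewrite distrC.
- move=> t /andP[t0 th]; have ht : 0 <= t <= h by rewrite t0 ltW.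
  split; first exact: CR_superharmonic (CRF t ht).
  have h1 := near_fluid hw (fs t ht).
  apply: (@filterS _ (nbhs _) _ _ _ _ h1) => z /fluid_closure cz.
  by have := esw_speed_le hw cz; rewrite -oppr_ge0 opprB.
- by rewrite subr_gt0 mulN1r; apply: le_lt_trans uh; exact: ler_norm.
Qed.

(* Constant by Bernoulli's law. *)
Let energy (z : R * R) : R := sqspeed z / 2 + g * z.2 + P z.

Let is_derive_energy_x (z : R * R) : fluid eta z ->
  is_derive z.1 1 (fun s => energy (s, z.2)) 0.
Proof.
move=> fz; have [du _ _ _] := C1_is_derive u1 fz.
have [dv _ _ _] := C1_is_derive v1 fz; have [dP _ _ _] := C1_is_derive P1 fz.
have e : is_derive z.1 1
  (fun s => ((u (s, z.2) - c) ^+ 2 + v (s, z.2) ^+ 2) * 2^-1 + g * z.2 + P (s, z.2))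
  ((u z - c) * dx u z + v z * dx v z + dx P z).
  by apply: is_derive_eq; rewrite /GRing.scale/= -surjective_pairing; field.
move/is_derive_eq : e; apply.
by rewrite (irrotational_dx fz); have := sw_euler_x hs fz; lra.
Qed.

Let is_derive_energy_y (z : R * R) : fluid eta z ->
  is_derive z.2 1 (fun s => energy (z.1, s)) 0.
Proof.
move=> fz; have [_ du _ _] := C1_is_derive u1 fz.
have [_ dv _ _] := C1_is_derive v1 fz; have [_ dP _ _] := C1_is_derive P1 fz.
have e : is_derive z.2 1
  (fun s => ((u (z.1, s) - c) ^+ 2 + v (z.1, s) ^+ 2) * 2^-1 + g * s + P (z.1, s))
  ((u z - c) * dy u z + v z * dy v z + g + dy P z).
  by apply: is_derive_eq; rewrite /GRing.scale/= -surjective_pairing; field.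
move/is_derive_eq : e; apply.
by rewrite -(irrotational_dx fz); have := sw_euler_y hs fz; lra.
Qed.

Let energy_vertical (x y t : R) : fluid eta (x, y) -> 0 <= t ->
  energy (x, y - t) = energy (x, y).
Proof.
move=> fz t0.
have d (s : R) : `|s - (y - t)| <= `|y - (y - t)| ->
    is_derive s 1 (fun s => energy (x, s)) ((fun=> 0) s).
  rewrite subKr [`|t|]ger0_norm// ler_norml => /andP[s1 s2].
  by apply: (@is_derive_energy_y (x, s)); move: fz; rewrite /fluid/=; lra.
have [s _] := MVT_is_derive d.
by rewrite mul0r => /eqP; rewrite subr_eq0 => /eqP.
Qed.

(** The two points are joined by a path going down to the common level [Y], along it and up
    again. *)
Let energy_fluid (x y y0 : R) : fluid eta (x, y) -> fluid eta (0, y0) ->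
  energy (x, y) = energy (0, y0).
Proof.
move=> fz f0; have [h h0 deep] := deep_point x y.
pose Y := Num.min (y - h) y0.
have [Y1 Y2] : Y <= y - h /\ Y <= y0 by rewrite /Y !ge_min !lexx orbT.
have hY : h <= y - Y by lra.
have [fY _] := deep _ hY.
rewrite -(energy_vertical fz (t := y - Y)); last by lra.
rewrite -(energy_vertical f0 (t := y0 - Y)); last by lra.
rewrite !subKr.
have d (s : R) : `|s - 0| <= `|x - 0| ->
    is_derive s 1 (fun s => energy (s, Y)) ((fun=> 0) s).
  rewrite !subr0 => sx; apply: (@is_derive_energy_x (s, Y)).
  by have := fY s sx; rewrite subKr.
have [s _] := MVT_is_derive d.
by rewrite mul0r => /eqP; rewrite subr_eq0 => /eqP.
Qed.

Let energy_cvg (z : R * R) : closure (fluid eta) z ->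
  energy w @[w --> within (closure (fluid eta)) (nbhs z)] --> energy z.
Proof.
move=> cz; apply: cvgD; last exact: closure_cvg.
apply: cvgD; first by apply: cvgMl; exact: sqspeed_cvg.
apply: cvgMr; apply: cvg_within_filter; exact: continuous_snd2.
Qed.

Lemma crest0 : @crest_abscissa R 0.
Proof. by exists 0; rewrite mul0r. Qed.

(** By continuity the energy is constant up to the surface, and its value is read off at the crest,
    where the velocity in the moving frame vanishes. *)
Lemma bernoulli (z : R * R) : closure (fluid eta) z ->
  sqspeed z = 2 * (patm - P z) + 2 * g * (eta 0 - z.2).
Proof.
have f0 : fluid eta (0, eta 0 - 1) by rewrite /fluid/=; lra.
have const w : closure (fluid eta) w -> energy w = energy (0, eta 0 - 1).
  move=> cw; apply/eqP; rewrite -subr_eq0 -normr_le0 leNgt; apply/negP => e0.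
  have /cvgrPdist_lt/(_ _ e0) := energy_cvg cw.
  move=> /cw[[x y] [fxy /(_ (fluid_closure fxy))]].
  by rewrite (energy_fluid fxy f0) ltxx.
have c0' : closure (fluid eta) (0, eta 0) by exact: closure_fluid.
move=> /const; rewrite -(const _ c0') /energy {2}/sqspeed.
have [-> ->] := esw_stagnation hw crest0.
rewrite (sw_dynamic hs) /= subrr expr0n/=; lra.
Qed.

Lemma sqspeed_surface (x : R) : sqspeed (x, eta x) = 2 * g * (eta 0 - eta x).
Proof. by rewrite bernoulli ?(sw_dynamic hs) ?subrr ?mulr0 ?add0r//; exact: closure_fluid. Qed.

Lemma deep_pressure : exists M : R, forall z, fluid eta z -> z.2 < M -> patm < P z.
Proof.
have [M0 [_ MP]] := sw_depth hs c0.
(* Where [|u| < c] and [|v| < c], the squared speed is at most [4 c^2 + c^2]; below this level the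
   gravity term exceeds that bound. *)
exists (Num.min M0 (eta 0 - 5 * c ^+ 2 / (2 * g))) => -[x y] fz.
rewrite lt_min/= => /andP[/MP/(_ x fz)[ub vb] yb].
have := bernoulli (fluid_closure fz); rewrite /sqspeed/=.
have : 5 * c ^+ 2 / (2 * g) < eta 0 - y by lra.
rewrite ltr_pdivrMr ?mulr_gt0// => hg.
have hv : v (x, y) ^+ 2 <= c ^+ 2.
  by rewrite -real_normK ?num_real// lerXn2r ?nnegrE ?(ltW vb)// ltW.
have hu : (u (x, y) - c) ^+ 2 <= (2 * c) ^+ 2.
  have c20 : 0 <= 2 * c by rewrite mulr_ge0// ltW.
  rewrite -[leLHS]real_normK ?num_real// lerXn2r ?nnegrE//.
  apply: (le_trans (ler_normB _ _)).
  by rewrite [`|c|]gtr0_norm//; lra.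
move=> hb.
have : (2 * c) ^+ 2 = 4 * c ^+ 2 by ring.
by nra.
Qed.

(** [P] is an affine function of the height minus a convex function of the velocity. Replacing the
    latter by its tangent at the velocity of [z] gives a majorant that is affine in [u], [v] and the
    height, hence harmonic. *)
Lemma superharmonic_P (z : R * R) : fluid eta z -> superharmonic_at P z.
Proof.
move=> fz.
pose U := u z - c; pose V := v z.
have := CR_near_quadratic (patm + g * eta 0 - sqspeed z / 2 + U * u z + V * v z) 0 (- g) 0 0 z.
move=> /CR_nearD/(_ (CR_nearZ (- U) (CR_near_u fz))).
move=> /CR_nearD/(_ (CR_nearZ (- V) (CR_near_v fz))) CRG.
eexists; eexists; split; first exact: CRG.
  apply: (fluid_nearW fz) => w fw.
  have := bernoulli (fluid_closure fw); rewrite /sqspeed => bw.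
  have h1 := sqr_ge0 (u w - u z); have h2 := sqr_ge0 (v w - v z).
  rewrite /U /V; nra.
have := bernoulli (fluid_closure fz); rewrite /sqspeed => bw.
rewrite /U /V; nra.
Qed.

Lemma pressure_ge (z : R * R) : closure (fluid eta) z -> patm <= P z.
Proof.
have [M deep] := deep_pressure.
(* The period is cut one unit below [M]: a point of pressure less than [patm] has height at least
   [M], so it is not on the bottom. *)
pose M' := M - 1.
pose K : set (R * R) := [set z | 0 <= z.1] `&` [set z | 0 <= 2 * pi - z.1] `&`
  [set z | 0 <= z.2 - M'] `&` [set z | 0 <= eta z.1 - z.2].
have KE (x y : R) : K (x, y) <-> [/\ 0 <= x, x <= 2 * pi, M' <= y & y <= eta x].
  by rewrite /K/= !subr_ge0; split; [case; case; case|case=> *; split; [split; [split|]|]].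
have Kcl w : K w -> closure (fluid eta) w.
  by case: w => x y /KE[_ _ _ yx]; exact: closure_fluid.
have cK : compact K.
  apply: (@compact_box R 0 (2 * pi) M' (eta 0)).
    apply: closedI; first apply: closedI; first apply: closedI; apply: closed_ge0.
    - exact: continuous_fst2.
    - move=> w; apply: cvgB; [exact: cst_continuous|exact: continuous_fst2].
    - move=> w; apply: cvgB; [exact: continuous_snd2|exact: cst_continuous].
    - exact: continuous_depth hw.
  move=> [x y] /KE[x0 x2 yM yx]; split => //=.
  apply: (le_trans yx).
  by apply: (eta_chord hw (s := 0)) => //; rewrite subr0.
have cF : {within K, continuous (fun w => P w - patm)}.
  apply/within_continuousP => w Kw e e0.
  have /within_continuousP/(_ w (Kcl w Kw) e e0) h := cP.
  apply: (@filterS _ (nbhs w) _ _ _ _ h) => t ht /Kcl /ht.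
  by rewrite opprD opprK addrACA addNr addr0.
have min := minimum_principle cK cF.
have {}min : forall w, K w -> 0 <= P w - patm.
  apply: min => -[x y] /KE[x0 x2 yM yx] F0 Fmin.
  have yx' : y < eta x.
    rewrite lt_neqAle yx andbT; apply/eqP => ye; move: F0.
    by rewrite ye (sw_dynamic hs) subrr ltxx.
  have yM' : M <= y.
    rewrite leNgt; apply/negP => /(deep (x, y) yx'); apply/negP; rewrite -leNgt.
    by move: F0; rewrite subr_lt0 => /ltW.
  split.
  - have := superharmonic_atD (superharmonic_P (z := (x, y)) yx') (CR_near_cst _ (- patm)).
    exact.
  - have h1 := near_fluid hw (z := (x, y)) yx'.
    have h2 : \forall z \near (x, y), M' < z.2.
      by apply: near_gt; [exact: continuous_snd2|rewrite /M'/=; lra].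
    have h : \forall z \near (x, y), fluid eta z /\ M' < z.2 by exact: filterI h1 h2.
    apply: (@filterS _ (nbhs (x, y)) _ _ _ _ h) => -[x1 y1] [f1 /= My1].
    (* The minimum may lie on a vertical side of the period; its neighbours beyond that side are
       moved back by periodicity. *)
    have [x' /andP[x'0 x'2] [ex' Px']] := periodic_strip hw x1.
    rewrite -Px'; last exact: ltW.
    by apply: Fmin; apply/KE; split; rewrite ?ex' //; exact: ltW.
  - have h1 : \forall t \near (0 : R), y + t < eta x.
      apply: (near_lt (f := fun t => y + t)); last by rewrite addr0.
      by apply: cvgD; [exact: cst_continuous|exact: cvg_id].
    have h2 : \forall t \near (0 : R), M' < y + t.
      apply: (near_gt (f := fun t => y + t)); last by rewrite addr0 /M'; lra.
      by apply: cvgD; [exact: cst_continuous|exact: cvg_id].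
    near=> t; apply/KE; split => //=; apply: ltW; by near: t.
case: z => x y cz; have yx := closure_fluid_le hw cz.
have [->|ye] := eqVneq y (eta x); first by rewrite (sw_dynamic hs).
have fz : fluid eta (x, y) by rewrite /fluid/= lt_neqAle ye.
have [yM|yM] := leP M' y; last by apply/ltW/deep => //=; rewrite /M' in yM; lra.
have [x' /andP[x'0 x'2] [ex' Px']] := periodic_strip hw x.
rewrite -Px'// -subr_ge0; apply: (min (x', y)); apply/KE; split => //.
by rewrite ex'.
Unshelve. all: end_near. Qed.

(** The strong minimum principle on a segment descending to where [deep_pressure] applies. *)
Lemma pressure_gt (z : R * R) : fluid eta z -> patm < P z.
Proof.
case: z => x y fz; have [M deep] := deep_pressure.
pose h := Num.max 1 (y - M + 1).
have [h1 h2] : 1 <= h /\ y - M + 1 <= h by rewrite /h !le_max !lexx orbT.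
have fs t : 0 <= t <= h -> fluid eta (x, y + (-1) * t).
  by move: fz; rewrite /fluid/= => fz /andP[t0 _]; lra.
rewrite -subr_gt0.
apply: (@strong_minimum_principle R (fun z => P z - patm) x y h (-1)).
- by lra.
- by rewrite oppr_eq0 oner_eq0.
- apply/within_continuousP => w [w1 [t ht w2]] e e0.
  have cw : closure (fluid eta) w.
    by apply: fluid_closure; rewrite [w]surjective_pairing w1 w2; exact: fs.
  have /within_continuousP/(_ w cw e e0) k := cP.
  apply: (@filterS _ (nbhs w) _ _ _ _ k) => s ks [s1 [t' ht' s2]].
  have fs' : fluid eta s by rewrite [s]surjective_pairing s1 s2; exact: fs.
  have := ks (fluid_closure fs').
  by rewrite opprD opprK addrACA addNr addr0.
- move=> t /andP[t0 th]; have ht : 0 <= t <= h by rewrite t0 ltW.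
  split.
    have := superharmonic_atD (superharmonic_P (fs t ht)) (CR_near_cst _ (- patm)).
    exact.
  apply: (fluid_nearW (fs t ht)) => w fw.
  by rewrite subr_ge0; exact: pressure_ge (fluid_closure fw).
- rewrite subr_gt0; apply: deep; last by rewrite /=; lra.
  by apply: fs; rewrite lexx andbT; lra.
Qed.

End Pressure.

(** * The logarithm of the squared speed *)

Section LogSpeed.
Variables (R : realType) (g c patm : R) (eta : R -> R) (u v P : R * R -> R).
Hypothesis hw : extreme_stokes_wave g c patm eta u v P.
Let hs := esw_stokes hw.
Let pi2E : (pi *+ 2 : R) = 2 * pi. Proof. by rewrite mulr_natl. Qed.
Let g0 : 0 < g := sw_gravity hs.
Let c0 : 0 < c := sw_speed hs.
Let u1 : C1_on (fluid eta) u. Proof. by case: (sw_u_C1 hs). Qed.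
Let v1 : C1_on (fluid eta) v. Proof. by case: (sw_v_C1 hs). Qed.
Local Notation speed2 := (sqspeed c u v).

Definition logspeed (z : R * R) : R := ln (speed2 z).

Lemma sqspeed_fluid_gt0 (z : R * R) : fluid eta z -> 0 < speed2 z.
Proof.
move=> fz; rewrite /sqspeed ltr_pwDl ?sqr_ge0// exprn_even_gt0//=.
by rewrite lt_eqF// subr_lt0; exact: speed_lt hw _ fz.
Qed.

Lemma sqspeed_gt0 (x y : R) : y <= eta x -> y < eta 0 -> 0 < speed2 (x, y).
Proof.
rewrite le_eqVlt => /predU1P[->|yx] y0; last exact: sqspeed_fluid_gt0.
by rewrite (sqspeed_surface hw) !mulr_gt0// subr_gt0.
Qed.

(** By the first Euler equation the numerator is [- 2 * dx P], so [dx P] and the slope of [logspeed]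
    in [x] have opposite signs. *)
Lemma is_derive_logspeed_x (z : R * R) : fluid eta z ->
  is_derive z.1 1 (fun s => logspeed (s, z.2))
    (2 * ((u z - c) * dx u z + v z * dy u z) / speed2 z).
Proof.
move=> fz; have [du _ _ _] := C1_is_derive u1 fz; have [dv _ _ _] := C1_is_derive v1 fz.
have s0 := sqspeed_fluid_gt0 fz.
have e : is_derive z.1 1 (fun s => (u (s, z.2) - c) ^+ 2 + v (s, z.2) ^+ 2)
   (2 * ((u z - c) * dx u z + v z * dy u z)).
  apply: is_derive_eq; rewrite /GRing.scale/= -surjective_pairing (irrotational_dx hw fz); ring.
have l : is_derive ((u (z.1, z.2) - c) ^+ 2 + v (z.1, z.2) ^+ 2) 1 (@ln R) (speed2 z)^-1.
  rewrite -surjective_pairing; exact: is_derive1_ln.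
have := is_derive1_comp (f := @ln R) (g := fun s => (u (s, z.2) - c) ^+ 2 + v (s, z.2) ^+ 2) l e.
by rewrite mulrC.
Qed.

Lemma is_derive_logspeed_y (z : R * R) : fluid eta z ->
  is_derive z.2 1 (fun s => logspeed (z.1, s))
    (2 * ((u z - c) * dy u z - v z * dx u z) / speed2 z).
Proof.
move=> fz; have [_ du _ _] := C1_is_derive u1 fz; have [_ dv _ _] := C1_is_derive v1 fz.
have s0 := sqspeed_fluid_gt0 fz.
have e : is_derive z.2 1 (fun s => (u (z.1, s) - c) ^+ 2 + v (z.1, s) ^+ 2)
   (2 * ((u z - c) * dy u z - v z * dx u z)).
  apply: is_derive_eq; rewrite /GRing.scale/= -surjective_pairing (mass_dy hw fz); ring.
have l : is_derive ((u (z.1, z.2) - c) ^+ 2 + v (z.1, z.2) ^+ 2) 1 (@ln R) (speed2 z)^-1.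
  rewrite -surjective_pairing; exact: is_derive1_ln.
have := is_derive1_comp (f := @ln R) (g := fun s => (u (z.1, s) - c) ^+ 2 + v (z.1, s) ^+ 2) l e.
by rewrite mulrC.
Qed.

(* [logspeed + i angle] is [2 log (u - c - i v)], up to a constant. *)
Let angle (z : R * R) : R := 2 * atan (- v z / (u z - c)).

(** Stated along a curve of velocities [(p, q)], so that one formula gives both partial derivatives
    of [angle]. As [p t < c], the quotient inside the arctangent has no pole. *)
Let is_derive_angle (p q : R -> R) (t p' q' : R) : is_derive t 1 p p' ->
  is_derive t 1 q q' -> p t - c < 0 ->
  is_derive t 1 (fun s => 2 * atan (- q s / (p s - c)))
    (- (2 * ((p t - c) * q' - q t * p') / ((p t - c) ^+ 2 + q t ^+ 2))).
Proof.
move=> dp dq pc.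
have pc0 : p t - c != 0 by rewrite lt_eqF.
have e1 : is_derive t 1 (fun s => p s - c) p' by apply: is_derive_eq; rewrite subr0.
have e2 := is_deriveV (f := fun s => p s - c) pc0 e1.
have e3 : is_derive t 1 (fun s => - q s / (p s - c)) (- q' / (p t - c) + q t * p' / (p t - c) ^+ 2).
  by apply: is_derive_eq; rewrite /GRing.scale/=; field.
have l : is_derive (- q t / (p t - c)) 1 atan (1 + (- q t / (p t - c)) ^+ 2)^-1.
  by exact: is_derive1_atan.
have e4 := is_derive1_comp (f := atan) (g := fun s => - q s / (p s - c)) l e3.
have e5 := is_deriveZ 2 e4.
move/is_derive_eq : e5; apply; rewrite /GRing.scale/=.
have h : (p t - c) ^+ 2 + q t ^+ 2 != 0.
  by rewrite gt_eqF// ltr_pwDl ?sqr_ge0// exprn_even_gt0.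
by field; rewrite h pc0.
Qed.

Lemma CR_near_logspeed (z : R * R) : fluid eta z -> CR_near z logspeed angle.
Proof.
move=> fz.
have cquo (f : R * R -> R) (w : R * R) : fluid eta w -> {for w, continuous f} ->
    {for w, continuous (fun z => 2 * f z / speed2 z)}.
  move=> fw cf; apply: cvgM; first by apply: cvgMr.
  apply: cvgV; first by rewrite gt_eqF// sqspeed_fluid_gt0.
  have cu := CR_continuous (CR_near_u hw fw); have cv := CR_continuous (CR_near_v hw fw).
  apply: cvgD; rewrite expr2; under eq_fun do rewrite expr2; apply: cvgM => //.
    by apply: cvgB => //; exact: cvg_cst.
  by apply: cvgB => //; exact: cvg_cst.
exists (fun z => 2 * ((u z - c) * dx u z + v z * dy u z) / speed2 z),
  (fun z => 2 * - ((u z - c) * dy u z - v z * dx u z) / speed2 z).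
have ca (w : R * R) : fluid eta w ->
   {for w, continuous (fun z => (u z - c) * dx u z + v z * dy u z)}.
  move=> fw; have [_ _ cx cy] := C1_is_derive u1 fw.
  have cu := CR_continuous (CR_near_u hw fw); have cv := CR_continuous (CR_near_v hw fw).
  apply: cvgD; apply: cvgM => //; apply: cvgB => //; exact: cvg_cst.
have cb (w : R * R) : fluid eta w ->
   {for w, continuous (fun z => (u z - c) * dy u z - v z * dx u z)}.
  move=> fw; have [_ _ cx cy] := C1_is_derive u1 fw.
  have cu := CR_continuous (CR_near_u hw fw); have cv := CR_continuous (CR_near_v hw fw).
  apply: cvgB; apply: cvgM => //; apply: cvgB => //; exact: cvg_cst.
split.
  apply: (partials_near_eq (F := logspeed)
    (a := fun z => 2 * ((u z - c) * dx u z + v z * dy u z) / speed2 z)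
    (b := fun z => 2 * ((u z - c) * dy u z - v z * dx u z) / speed2 z)) => //.
    by move=> w; rewrite mulrN mulNr opprK.
  apply: (fluid_nearW hw fz) => w fw; split.
  - exact: is_derive_logspeed_x.
  - exact: is_derive_logspeed_y.
  - exact: cquo (ca w fw).
  - exact: cquo (cb w fw).
apply: (fluid_nearW hw fz) => w fw.
have [dux duy _ _] := C1_is_derive u1 fw; have [dvx dvy _ _] := C1_is_derive v1 fw.
have uc : u w - c < 0 by rewrite subr_lt0; exact: speed_lt hw _ fw.
split.
- have := is_derive_angle (p := fun s => u (s, w.2)) (q := fun s => v (s, w.2)) dux dvx.
  rewrite -surjective_pairing => /(_ uc)/is_derive_eq; apply.
  by rewrite (irrotational_dx hw fw) mulrN mulNr.
- have := is_derive_angle (p := fun s => u (w.1, s)) (q := fun s => v (w.1, s)) duy dvy.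
  rewrite -surjective_pairing => /(_ uc)/is_derive_eq; apply.
  by rewrite (mass_dy hw fw) mulrN -opprD mulrN mulNr opprK.
- apply: cquo => //; apply: cvgN; exact: cb w fw.
- exact: cquo (ca w fw).
Qed.

Lemma dx_pressure (z : R * R) : fluid eta z ->
  dx P z = - ((u z - c) * dx u z + v z * dy u z).
Proof. by move=> fz; rewrite (sw_euler_x hs fz) opprK. Qed.

Lemma logspeed_cvg (z : R * R) : closure (fluid eta) z -> 0 < speed2 z ->
  logspeed w @[w --> within (closure (fluid eta)) (nbhs z)] --> logspeed z.
Proof.
by move=> cz z0; exact: (continuous_cvg _ (continuous_ln z0) (sqspeed_cvg hw cz)).
Qed.

(** Makes both terms of [logspeed_diff] approach the same constant at great depth. *)
Lemma logspeed_deep (e : R) : 0 < e -> exists M : R, forall z, fluid eta z ->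
  z.2 < M -> `|logspeed z - ln (c ^+ 2)| < e.
Proof.
move=> e0.
have cl : {for (0, 0), continuous (fun s : R * R => ln ((s.1 - c) ^+ 2 + s.2 ^+ 2))}.
  apply: (continuous_comp (f := fun s : R * R => (s.1 - c) ^+ 2 + s.2 ^+ 2) (g := @ln R)).
    apply: cvgD; rewrite expr2; under eq_fun do rewrite expr2.
      by apply: cvgM; apply: cvgB; (try exact: cvg_cst); exact: continuous_fst2.
    by apply: cvgM; exact: continuous_snd2.
  by apply: continuous_ln; rewrite /= sub0r sqrrN expr0n addr0 exprn_gt0.
have [r r0 lr] := (cvg2P _ _).1 cl e e0.
have [M [_ MP]] := sw_depth hs r0.
exists M => -[x y] fz /MP/(_ x fz)[ur vr].
have := lr (u (x, y)) (v (x, y)); rewrite !subr0 => /(_ ur vr).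
by rewrite /= sub0r sqrrN expr0n/= addr0.
Qed.

(** * Comparison with the mirror image in the line [x = x0] *)

Section Translate.
Variable x0 : R.
Hypothesis x0pi : 0 < x0 < pi.

(* By parity this is also the difference between the point and its mirror image
   in the line [x = x0]. *)
Definition logspeed_diff (z : R * R) : R :=
  logspeed z + -1 * logspeed (z + (- (2 * x0), 0)).

Let diffE (x y : R) : logspeed_diff (x, y) = logspeed (x, y) - logspeed (x - 2 * x0, y).
Proof. by rewrite /logspeed_diff mulN1r/= -[(x, y) + _]/(x - 2 * x0, y + 0) addr0. Qed.

Let CR_near_diff (x y : R) : fluid eta (x, y) -> fluid eta (x - 2 * x0, y) ->
  exists H, CR_near (x, y) logspeed_diff H.
Proof.
move=> f1 f2; have h1 := CR_near_logspeed f1.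
have f2' : fluid eta ((x, y) + (- (2 * x0), 0)).
  by rewrite -[(x, y) + _]/(x - 2 * x0, y + 0) addr0.
have h2 := CR_near_translate (CR_near_logspeed f2').
eexists; exact: CR_nearD h1 (CR_nearZ (-1) h2).
Qed.

(** Half a wavelength wide: [logspeed_diff] vanishes on the left side by parity, and on the right
    side by parity and periodicity. *)
Definition strip : set (R * R) := [set z | [/\ x0 <= z.1, z.1 <= x0 + pi & z.2 <= eta z.1]].

Let strip_lt0 (x y : R) : strip (x, y) -> y < eta 0.
Proof.
move=> [/= h1 h2 h3]; apply: (le_lt_trans h3); apply: (eta_lt0 hw).
by move: x0pi => /andP[? ?]; apply/andP; split; lra.
Qed.

Let strip_translate (x y : R) : strip (x, y) -> y <= eta (x - 2 * x0).
Proof.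
move=> [/= h1 h2 h3]; apply: (le_trans h3); apply: (eta_translate_le hw) => //.
by rewrite h1.
Qed.

Let strip_closure (z : R * R) : strip z -> closure (fluid eta) z.
Proof. by case: z => x y [_ _ h3]; exact: closure_fluid. Qed.

Let strip_interior (x y : R) : x0 < x < x0 + pi -> y < eta x ->
  fluid eta (x, y) /\ fluid eta (x - 2 * x0, y).
Proof.
by move=> xx yx; split=> //; apply: (lt_trans yx); exact: (eta_translate_lt hw).
Qed.

(** Points of the strip and their translates lie in the closed fluid below crest level, away from
    the stagnation points, so both logarithms are continuous up to the surface. *)
Lemma continuous_diff (A : set (R * R)) : A `<=` strip -> {within A, continuous logspeed_diff}.
Proof.
move=> As; apply: continuous_subspaceW As _.
apply/within_continuousP => -[x y] sz e e0.
have yx : closure (fluid eta) (x, y) by exact: strip_closure.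
have yt := strip_translate sz; have y0 := strip_lt0 sz.
have yt' : closure (fluid eta) (x - 2 * x0, y) by exact: closure_fluid.
have [_ _ yx'] := sz.
have e20 : 0 < e / 2 by rewrite divr_gt0.
have /cvgrPdist_lt/(_ _ e20) h1 := logspeed_cvg yx (sqspeed_gt0 yx' y0).
have /cvgrPdist_lt/(_ _ e20) h2 := logspeed_cvg yt' (sqspeed_gt0 yt y0).
have ct : {for (x, y), continuous (fun z : R * R => (z.1 - 2 * x0, z.2))}.
  apply: (continuous_pair (f := fun z : R * R => z.1 - 2 * x0)); last exact: continuous_snd2.
  by apply: cvgB; [exact: continuous_fst2|exact: cst_continuous].
have {}h2 := ct _ h2.
near=> z => sz'.
have : closure (fluid eta) z -> `|logspeed (x, y) - logspeed z| < e / 2.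
  by near: z; exact: h1.
have : closure (fluid eta) (z.1 - 2 * x0, z.2) ->
    `|logspeed (x - 2 * x0, y) - logspeed (z.1 - 2 * x0, z.2)| < e / 2.
  by near: z; exact: h2.
move=> k2 /(_ (strip_closure sz')) k1.
have sz2 : strip (z.1, z.2) by rewrite -surjective_pairing.
have {}k2 := k2 (closure_fluid (z := (z.1 - 2 * x0, z.2)) (strip_translate sz2)).
have -> : logspeed_diff z = logspeed z - logspeed (z.1 - 2 * x0, z.2).
  by rewrite {1}[z]surjective_pairing diffE -surjective_pairing.
rewrite diffE.
have -> : logspeed z - logspeed (z.1 - 2 * x0, z.2) -
   (logspeed (x, y) - logspeed (x - 2 * x0, y)) =
   (logspeed (x - 2 * x0, y) - logspeed (z.1 - 2 * x0, z.2)) -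
   (logspeed (x, y) - logspeed z) by ring.
by rewrite (le_lt_trans (ler_normB _ _))//; lra.
Unshelve. all: end_near. Qed.

Let diff_left (y : R) : y <= eta x0 -> logspeed_diff (x0, y) = 0.
Proof.
move=> yx; rewrite diffE.
have -> : x0 - 2 * x0 = - x0 by ring.
have cz : closure (fluid eta) (x0, y) by exact: closure_fluid.
rewrite /logspeed /sqspeed (sw_u_even hs cz) (sw_v_odd hs cz) sqrrN; ring.
Qed.

Let diff_right (y : R) : y <= eta (x0 + pi) -> logspeed_diff (x0 + pi, y) = 0.
Proof.
move=> yx; rewrite diffE.
have -> : x0 + pi - 2 * x0 = - (x0 - pi) by ring.
have e : eta (x0 - pi) = eta (x0 + pi).
  by rewrite -(sw_eta_periodic hs (x0 - pi)) pi2E; congr eta; ring.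
have cz : closure (fluid eta) (x0 - pi, y) by apply: closure_fluid; rewrite /= e.
have -> : x0 + pi = (x0 - pi) + pi *+ 2 by rewrite pi2E; ring.
rewrite /logspeed /sqspeed (sw_u_even hs cz) (sw_v_odd hs cz) sqrrN.
rewrite (sw_u_periodic hs cz) (sw_v_periodic hs cz); ring.
Qed.

(** The two points have equal heights, so by Bernoulli's law their squared speeds differ by twice
    the excess of the pressure over [patm] at the translate. *)
Let diff_surface (x : R) : x0 <= x <= x0 + pi -> 0 <= logspeed_diff (x, eta x).
Proof.
move=> /andP[h1 h2]; have sz : strip (x, eta x) by [].
rewrite diffE subr_ge0 /logspeed ler_ln ?posrE.
- rewrite (sqspeed_surface hw) (bernoulli hw); last first.
    exact: (closure_fluid (z := (x - 2 * x0, eta x)) (strip_translate sz)).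
  have := pressure_ge hw (closure_fluid (z := (x - 2 * x0, eta x)) (strip_translate sz)).
  by move=> Pge; rewrite gerDr/=; lra.
- by apply: sqspeed_gt0; [exact: strip_translate|exact: strip_lt0 sz].
- by apply: sqspeed_gt0 => //; exact: strip_lt0 sz.
Qed.

Let diff_surface_gt0 (x : R) : x0 < x < x0 + pi -> 0 < logspeed_diff (x, eta x).
Proof.
move=> xx; move: (xx) => /andP[h1 h2].
have sz : strip (x, eta x) by split => //=; exact: ltW.
rewrite diffE subr_gt0 /logspeed ltr_ln ?posrE.
- have ft : fluid eta (x - 2 * x0, eta x) by exact: (eta_translate_lt hw).
  rewrite (sqspeed_surface hw) (bernoulli hw); last exact: fluid_closure.
  have := pressure_gt hw ft.
  by move=> Pge; rewrite gtrDr/=; lra.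
- by apply: sqspeed_gt0; [exact: strip_translate|exact: strip_lt0 sz].
- by apply: sqspeed_gt0 => //; exact: strip_lt0 sz.
Qed.

(** Adding [e] makes the difference positive on the bottom of a deep truncation, where each
    logarithm is within [e / 2] of its limit. A negative minimum is then excluded on all four
    sides. *)
Lemma diff_ge0 (z : R * R) : strip z -> 0 <= logspeed_diff z.
Proof.
move=> sz; apply/ler_addgt0Pr => e e0.
have e20 : 0 < e / 2 by rewrite divr_gt0.
have [M1 deep] := logspeed_deep e20.
have [x2 x2pi] : 0 < x0 /\ x0 < pi by apply/andP.
(* The bottom [M] must be low enough both to keep [z] in the truncated strip and to satisfy the
   depth estimate. *)
have [M Mz MM1] : exists2 M, M <= z.2 & M < M1.
  exists (Num.min z.2 (M1 - 1)); first by rewrite ge_min lexx.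
  by rewrite gt_min; apply/orP; right; lra.
pose K : set (R * R) := [set z | 0 <= z.1 - x0] `&` [set z | 0 <= x0 + pi - z.1] `&`
  [set z | 0 <= z.2 - M] `&` [set z | 0 <= eta z.1 - z.2].
have KE (x y : R) : K (x, y) <-> [/\ x0 <= x, x <= x0 + pi, M <= y & y <= eta x].
  by rewrite /K/= !subr_ge0; split; [case; case; case|case=> *; split; [split; [split|]|]].
have Ks w : K w -> strip w by case: w => x y /KE[? ? ? ?].
have cK : compact K.
  apply: (@compact_box R x0 (x0 + pi) M (eta 0)).
    apply: closedI; first apply: closedI; first apply: closedI; apply: closed_ge0.
    - by move=> w; apply: cvgB; [exact: continuous_fst2|exact: cst_continuous].
    - by move=> w; apply: cvgB; [exact: cst_continuous|exact: continuous_fst2].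
    - by move=> w; apply: cvgB; [exact: continuous_snd2|exact: cst_continuous].
    - exact: continuous_depth hw.
  move=> [x y] Kz; have /ltW := strip_lt0 (Ks _ Kz).
  by move: Kz => /KE[? ? ? ?].
have cF : {within K, continuous (fun w => logspeed_diff w + e)}.
  apply/within_continuousP => w Kw e' e'0.
  have /within_continuousP/(_ w Kw _ e'0) h := continuous_diff Ks.
  apply: (@filterS _ (nbhs w) _ _ _ _ h) => t ht /ht.
  by rewrite [- (logspeed_diff w + e)]opprD addrACA subrr addr0.
have min := minimum_principle cK cF.
rewrite addrC addrC; apply: (min _ z); last first.
  by rewrite [z]surjective_pairing; apply/KE; move: sz => [? ? ?].
move=> -[x y] Kxy F0 Fmin; have /KE[h1 h2 h3 h4] := Kxy.
have xx1 : x0 < x.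
  rewrite lt_neqAle h1 andbT; apply/eqP => xE; move: F0; rewrite -xE diff_left ?xE//.
  by rewrite add0r => /(lt_trans e0); rewrite ltxx.
have xx2 : x < x0 + pi.
  rewrite lt_neqAle h2 andbT; apply/eqP => xE; move: F0; rewrite xE diff_right -?xE//.
  by rewrite add0r => /(lt_trans e0); rewrite ltxx.
have xx : x0 < x < x0 + pi by rewrite xx1.
have yx : y < eta x.
  rewrite lt_neqAle h4 andbT; apply/eqP => yE; move: F0; rewrite yE.
  have := diff_surface (x := x); rewrite h1 h2 => /(_ isT); lra.
have [f1 f2] := strip_interior xx yx.
have yM : M < y.
  rewrite lt_neqAle h3 andbT; apply/eqP => yE; move: F0; rewrite diffE.
  have := deep _ f1; have := deep _ f2; rewrite -yE /= => /(_ MM1) + /(_ MM1).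
  rewrite !ltr_norml => /andP[? ?] /andP[? ?]; lra.
have nK : \forall w \near (x, y), K w.
  have n1 : \forall w \near (x, y), x0 < w.1.
    by apply: near_gt; [exact: continuous_fst2|].
  have n2 : \forall w \near (x, y), w.1 < x0 + pi.
    by apply: near_lt; [exact: continuous_fst2|].
  have n3 : \forall w \near (x, y), M < w.2.
    by apply: near_gt; [exact: continuous_snd2|].
  have n4 := near_fluid hw f1.
  near=> w; rewrite [w]surjective_pairing; apply/KE; split; apply: ltW; near: w => //.
have [H GH] := CR_near_diff f1 f2.
split.
- apply: CR_superharmonic; exact: CR_nearD GH (CR_near_cst _ e).
- by apply: (@filterS _ (nbhs (x, y)) _ _ _ _ nK); exact: Fmin.
- have wt : (fun t : R => (x, y + t)) t @[t --> 0] --> (x, y).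
    rewrite [X in _ --> X](_ : (x, y) = (x, y + 0)); last by rewrite addr0.
    apply: (continuous_pair (f := fun=> x) (g := fun t => y + t)); first exact: cst_continuous.
    by apply: cvgD; [exact: cst_continuous|exact: cvg_id].
  exact: wt _ nK.
Unshelve. all: end_near. Qed.

(** Here the segment of the strong minimum principle ascends, to the surface point above [(x, y)],
    where the difference is positive. *)
Lemma diff_gt0 (x y : R) : x0 < x < x0 + pi -> y < eta x -> 0 < logspeed_diff (x, y).
Proof.
move=> xx yx; have /andP[xx1 xx2] := xx.
have h0 : 0 < eta x - y by rewrite subr_gt0.
apply: (@strong_minimum_principle R logspeed_diff x y (eta x - y) 1) => //.
- apply: continuous_diff => -[x' y'] [/= -> [t /andP[_ t1] ->]].
  by split; rewrite /= ?mul1r; lra.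
- move=> t /andP[t0 t1].
  have ty : y + 1 * t < eta x by rewrite mul1r; lra.
  have [f1 f2] := strip_interior xx ty.
  split; first by have [H GH] := CR_near_diff f1 f2; exact: CR_superharmonic GH.
  have n1 : \forall w \near (x, y + 1 * t), x0 < w.1.
    by apply: near_gt; [exact: continuous_fst2|].
  have n2 : \forall w \near (x, y + 1 * t), w.1 < x0 + pi.
    by apply: near_lt; [exact: continuous_fst2|].
  have n4 := near_fluid hw f1.
  by near=> w; apply: diff_ge0; split; apply: ltW; near: w.
- by rewrite mul1r addrC subrK; exact: diff_surface_gt0.
Unshelve. all: end_near. Qed.

(** Hopf's lemma at [(x0, y)] with inner normal [(1, 0)] gives [logspeed_diff] at least linear
    growth to the right. By parity its value at [x0 + t] is [logspeed (x0 + t, y) - logspeed (x0 -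
    t, y)], which is [2 * a * t] to first order. *)
Lemma dx_pressure_lt0 (y : R) : y < eta x0 -> dx P (x0, y) < 0.
Proof.
move=> yx; have [x2 x2pi] : 0 < x0 /\ x0 < pi by apply/andP.
have fz : fluid eta (x0, y) by [].
have [r1 r10 near_r1] := (nearP2 _ _).1 (near_fluid hw fz).
pose r := Num.min (r1 / 2) (pi / 2).
have [r0 rr1 rpi] : [/\ 0 < r, r < r1 & r < pi].
  rewrite /r lt_min !gt_min; split; first by apply/andP; split; lra.
    by apply/orP; left; lra.
  by apply/orP; right; lra.
have hb (z : R * R) : half_box (x0, y) 1 0 r z -> strip z /\ fluid eta z.
  case: z => x' y' [/= h1 h2]; rewrite /linear_form/= mul0r mul1r addr0 subr_ge0 => h3.
  have f : fluid eta (x', y') by apply: near_r1; [exact: le_lt_trans h1 _|exact: le_lt_trans h2 _].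
  split => //; split => //=; last exact: ltW.
  by move: h1; rewrite ler_norml => /andP[]; lra.
have box_lt (z : R * R) : `|z.1 - x0| <= r -> 0 < linear_form (x0, y) 1 0 z -> x0 < z.1 < x0 + pi.
  rewrite /linear_form/= mul0r mul1r addr0 subr_gt0 => h1 ->/=.
  by move: h1; rewrite ler_norml => /andP[]; lra.
have [||||||e e0 he] := @hopf R logspeed_diff (x0, y) 1 0 r.
- exact: oner_neq0.
- exact: r0.
- by apply: continuous_diff => z /hb[].
- by move=> z /hb[sz _]; exact: diff_ge0.
- move=> [x' y'] hz hl; have [sz fz'] := hb _ hz.
  by apply: diff_gt0 => //; apply: (box_lt _ _ hl); case: hz.
- move=> [x' y'] h1 h2 h3.
  have hz : half_box (x0, y) 1 0 r (x', y') by split; exact: ltW.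
  have [sz fz'] := hb _ hz; have xx := box_lt _ (ltW h1) h3.
  have [f1 f2] := strip_interior xx fz'.
  by have [H GH] := CR_near_diff f1 f2; exact: CR_superharmonic GH.
have dl := is_derive_logspeed_x fz.
set a := 2 * _ / _ in dl.
(* Each of the two difference quotients errs by at most [e / 4], which leaves
   [e <= 2 * a + e / 2]. *)
have e40 : 0 < e / 4 by rewrite divr_gt0.
have [d d0 hd] := (is_derive1P _ _ _).1 dl _ e40.
pose t := Num.min (d / 2) r.
have [t0 td tr] : [/\ 0 < t, t < d & t <= r].
  by rewrite /t lt_min gt_min ge_min lexx orbT r0 andbT; split => //; [lra|apply/orP; left; lra].
have := hd t; have := hd (- t); rewrite normrN gtr0_norm// => /(_ td) k1 /(_ td) k2.
have hz : half_box (x0, y) 1 0 r (x0 + t, y).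
  split; rewrite /linear_form/= ?subrr ?normr0 ?(ltW r0)// addrAC subrr add0r.
    by rewrite gtr0_norm.
  by rewrite mul1r mul0r addr0 ltW.
have := he _ hz; rewrite diffE /barrier /linear_form/=.
have -> : x0 + t - 2 * x0 = - (x0 - t) by ring.
have cz : closure (fluid eta) (x0 - t, y).
  apply/fluid_closure/near_r1; rewrite /= ?subrr ?normr0//.
  by rewrite addrAC subrr add0r normrN gtr0_norm//; lra.
have -> : logspeed (- (x0 - t), y) = logspeed (x0 - t, y).
  by rewrite /logspeed /sqspeed (sw_u_even hs cz) (sw_v_odd hs cz) sqrrN.
move: k1 k2; rewrite !ler_norml/= => /andP[k1 _] /andP[_ k2] k3.
have t2 : 0 <= t ^+ 2 by exact: sqr_ge0.
have k4 : e * t <= 2 * a * t + 2 * (e / 4 * t).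
  have : e * t <= logspeed (x0 + t, y) - logspeed (x0 - t, y).
    apply: le_trans k3; rewrite ler_pM2l// -subr_ge0.
    suff -> : 1 * (x0 + t - x0) + 0 * (y - y) + (1 * (x0 + t - x0) + 0 * (y - y)) ^+ 2 -
      (- 0 * (x0 + t - x0) + 1 * (y - y)) ^+ 2 - t = t ^+ 2 by [].
    by ring.
  lra.
have a0 : 0 < a.
  have : e / 4 * t <= a * t by lra.
  by rewrite ler_pM2r//; exact: lt_le_trans.
rewrite (dx_pressure fz) oppr_lt0.
move: a0; rewrite /a pmulr_lgt0 ?invr_gt0 ?sqspeed_fluid_gt0//.
by rewrite pmulr_rgt0.
Qed.

End Translate.

End LogSpeed.

(** * The pressure gradient on the symmetry lines and on the free surface *)

Lemma symmetric_derive0 (R : realType) (f : R -> R) (x l : R) :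
  is_derive x 1 f l -> (\forall h \near (0 : R), f (x + h) = f (x - h)) -> l = 0.
Proof.
move=> df sym; apply/eqP; rewrite -normr_le0; apply/ler_addgt0Pr => e e0; rewrite add0r.
have [r r0 hr] := (is_derive1P _ _ _).1 df e e0.
have /nbhs_ballP[s /= s0] : \forall h \near (0 : R), f (x + h) = f (x - h) := sym.
rewrite -ball_normE /ball_/= => hs.
pose h := Num.min (r / 2) (s / 2).
have [h0 h1 h2] : [/\ 0 < h, h < r & h < s].
  rewrite /h lt_min !gt_min; split; first by apply/andP; split; lra.
    by apply/orP; left; lra.
  by apply/orP; right; lra.
have := hr h; have := hr (- h); rewrite normrN gtr0_norm// => /(_ h1) k1 /(_ h1) k2.
have := hs h; rewrite /= sub0r normrN gtr0_norm// => /(_ h2) k3.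
move: k1 k2; rewrite -k3 !ler_norml => /andP[k4 k5] /andP[k6 k7].
by apply/andP; split; rewrite -(ler_pM2r h0); lra.
Qed.

Section PressureGradient.
Variables (R : realType) (g c patm : R) (eta : R -> R) (u v P : R * R -> R).
Hypothesis hw : extreme_stokes_wave g c patm eta u v P.
Let hs := esw_stokes hw.
Let pi2E : (pi *+ 2 : R) = 2 * pi. Proof. by rewrite mulr_natl. Qed.
Let P1 : C1_on (fluid eta) P. Proof. by case: (sw_P_C1 hs). Qed.
Let cP : {within closure (fluid eta), continuous P}. Proof. by case: (sw_P_C1 hs). Qed.

(** Common to the crest-line and the trough-line; the symmetry of [P] is asked for only at points of
    the closed fluid. *)
Lemma dx_pressure_symmetric (x y : R) : (forall h, eta (x + h) = eta (x - h)) ->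
  (forall h, y <= eta (x + h) -> P (x + h, y) = P (x - h, y)) ->
  y < eta x -> dx P (x, y) = 0.
Proof.
move=> se sP yx; have [dP _ _ _] := C1_is_derive P1 (z := (x, y)) yx.
apply: symmetric_derive0 dP _ => /=.
have h1 : \forall h \near (0 : R), y < eta (x + h).
  apply: (near_gt (f := fun h => eta (x + h))); last by rewrite addr0.
  apply: (continuous_comp (f := fun h : R => x + h)); last exact: (sw_eta_continuous hs).
  by apply: cvgD; [exact: cst_continuous|exact: cvg_id].
by near=> h; apply: sP; apply: ltW; near: h.
Unshelve. all: end_near. Qed.

Lemma dx_pressure_crest (y : R) : y < eta 0 -> dx P (0, y) = 0.
Proof.
apply: dx_pressure_symmetric => h; first by rewrite add0r sub0r (sw_eta_even hs).
by rewrite add0r sub0r => yh; rewrite (sw_P_even hs)//; exact: closure_fluid.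
Qed.

Lemma dx_pressure_trough (y : R) : y < eta pi -> dx P (pi, y) = 0.
Proof.
apply: dx_pressure_symmetric => h; first by rewrite -(eta_sym hw); congr eta; ring.
move=> yh; have e : pi + h = - (pi - h) + pi *+ 2 by rewrite pi2E; ring.
have cz : closure (fluid eta) (pi - h, y).
  apply: closure_fluid => /=; apply: (le_trans yh).
  by rewrite -(eta_sym hw) le_eqVlt; apply/orP; left; apply/eqP; congr eta; ring.
have cz' : closure (fluid eta) (- (pi - h), y).
  by apply: closure_fluid; rewrite /= (sw_eta_even hs); exact: closure_fluid_le hw _ cz.
by rewrite e (sw_P_periodic hs)// (sw_P_even hs).
Qed.

Lemma dx_pressure_surface_cvg (x : R) : 0 < x < 2 * pi ->
  exists l : R, dx P z @[z --> within (fluid eta) (nbhs (x, eta x))] --> l.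
Proof.
move=> xx; case: (sw_P_C1 hs) => _ _ /(_ (x, eta x)) h.
have [|/cvg_ex[l hl] _] := h; last by exists l.
by split => //=; exact: crest_abscissa_inside.
Qed.

Lemma surface_limitP (f : R * R -> R) (x l : R) :
  f z @[z --> within (fluid eta) (nbhs (x, eta x))] --> l ->
  forall e, 0 < e -> exists2 r, 0 < r & forall x' y', `|x' - x| < r -> `|y' - eta x| < r ->
    y' < eta x' -> `|l - f (x', y')| < e.
Proof.
move=> /cvgrPdist_lt h e /h {}h.
have /nearP2[r r0 hr] : \forall z \near (x, eta x), fluid eta z -> `|l - f z| < e := h.
by exists r => // x' y' h1 h2 h3; exact: hr.
Qed.

(** The limit exists by regularity at the trough, so it can be computed along the trough-line, where
    [dx P] vanishes. *)
Lemma trough_limit : dx P z @[z --> within (fluid eta) (nbhs (pi, eta pi))] --> (0 : R).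
Proof.
have pi0 := pi_gt0 R.
have [|l hl] := @dx_pressure_surface_cvg pi; first by apply/andP; split; lra.
suff l0 : l = 0 by rewrite -[X in _ --> X]l0.
apply/eqP; rewrite -normr_le0; apply/ler_addgt0Pr => e e0; rewrite add0r.
have [r r0 hr] := surface_limitP hl e0.
have := hr pi (eta pi - r / 2); rewrite subrr normr0 addrAC subrr add0r normrN.
have yr : eta pi - r / 2 < eta pi by lra.
rewrite gtr0_norm ?divr_gt0// (dx_pressure_trough yr) subr0.
by move=> h; apply/ltW/h => //; lra.
Qed.

(** Convexity bounds [eta] at [x + t * (x' - x)] by the chord, differentiability bounds it below by
    the tangent; dividing by a small [t] leaves the claim up to an arbitrary [e]. *)
Lemma eta_tangent (x x' : R) : 0 < x < 2 * pi -> 0 <= x' <= 2 * pi ->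
  eta x + derive1 eta x * (x' - x) <= eta x'.
Proof.
move=> xx x'x; have /andP[x0 x2] := xx.
have [deta _] := sw_eta_C1 hs (@crest_abscissa_inside _ _ xx).
have d : is_derive x 1 eta (derive1 eta x) by apply: DeriveDef deta _; rewrite derive1E.
set m := derive1 eta x in d *.
rewrite -subr_ge0 opprD addrA; apply/ler_addgt0Pr => e e0.
pose k := `|x' - x| + 1.
have k0 : 0 < k by rewrite ltr_wpDl.
have [r r0 hr] := (is_derive1P _ _ _).1 d _ (divr_gt0 e0 k0).
pose t := Num.min 1 (r / (2 * k)).
have [t0 t1 tr] : [/\ 0 < t, t <= 1 & t <= r / (2 * k)].
  by rewrite /t lt_min !ge_min !lexx orbT ltr01 divr_gt0// mulr_gt0.
have hk : `|t * (x' - x)| = t * `|x' - x| by rewrite normrM gtr0_norm.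
have hk' : t * `|x' - x| < r.
  have : t * k <= r / 2.
    have -> : r / 2 = r / (2 * k) * k by field; rewrite gt_eqF.
    by rewrite ler_pM2r.
  rewrite /k mulrDr mulr1; lra.
have := hr (t * (x' - x)); rewrite hk => /(_ hk').
have cv : eta (x + t * (x' - x)) <= t * eta x' + (1 - t) * eta x.
  have -> : x + t * (x' - x) = t * x' + (1 - t) * x by ring.
  by apply: (eta_convex hw) => //; apply/andP; split => //; exact: ltW.
rewrite ler_norml => /andP[k1 _].
have k2 : e / k * (t * `|x' - x|) <= t * e.
  have -> : t * e = e / k * (t * k) by field; rewrite gt_eqF.
  rewrite ler_pM2l ?divr_gt0// ler_pM2l// /k; lra.
rewrite -(ler_pM2l t0) mulr0; lra.
Qed.

(** The tangent at [x], evaluated at [pi], does not exceed the trough height, which is less than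
    [eta x]. *)
Lemma derive_eta_lt0 (x : R) : 0 < x < pi -> derive1 eta x < 0.
Proof.
move=> /andP[x0 xp].
have h1 := @eta_tangent x pi; have h2 := @eta_lt _ _ _ _ _ _ _ _ hw x pi.
have {}h1 : eta x + derive1 eta x * (pi - x) <= eta pi by apply: h1; apply/andP; split; lra.
have {}h2 : eta pi < eta x by apply: h2; lra.
by rewrite -(pmulr_llt0 _ (_ : 0 < pi - x)); lra.
Qed.

(** If [l >= 0], then [dx P] would exceed a small negative number near the surface point. The mean
    value theorem on a short horizontal segment to the left contradicts the growth of [P - patm]
    given by Hopf's lemma. *)
Lemma surface_limit_lt0 (x : R) : 0 < x < pi ->
  exists2 l : R, dx P z @[z --> within (fluid eta) (nbhs (x, eta x))] --> l & l < 0.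
Proof.
move=> xpi; have /andP[x0 xp] := xpi.
have xx : 0 < x < 2 * pi by apply/andP; split; lra.
have [l hl] := dx_pressure_surface_cvg xx; exists l => //.
have m0 := derive_eta_lt0 xpi; set m := derive1 eta x in m0.
pose r := Num.min (x / 2) ((pi - x) / 2).
have [r0 r1 r2] : [/\ 0 < r, r < x & r < pi - x].
  rewrite /r lt_min !gt_min; split; first by apply/andP; split; lra.
    by apply/orP; left; lra.
  by apply/orP; right; lra.
clearbody r.
(* The linear form with normal [(m, -1)] is the depth below the tangent, so this is
   [eta_tangent]. *)
have below (z : R * R) : `|z.1 - x| <= r ->
    z.2 + linear_form (x, eta x) m (-1) z <= eta z.1.
  rewrite ler_norml /linear_form/= => /andP[h1 h2].
  have := @eta_tangent x z.1 xx; rewrite -/m => h.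
  have {}h : eta x + m * (z.1 - x) <= eta z.1 by apply: h; apply/andP; split; lra.
  lra.
have half_closure (z : R * R) : half_box (x, eta x) m (-1) r z -> closure (fluid eta) z.
  by move=> [h1 _ h3]; apply: closure_fluid; have := below _ h1; lra.
have half_inside (z : R * R) : `|z.1 - x| <= r ->
    0 < linear_form (x, eta x) m (-1) z -> fluid eta z.
  by move=> h1 h3; rewrite /fluid/=; have := below _ h1; lra.
have [||||||e e0 he] := @hopf R (fun z => P z - patm) (x, eta x) m (-1) r.
- by rewrite lt_eqF.
- exact: r0.
- apply/within_continuousP => w Kw e e0.
  have /within_continuousP/(_ w (half_closure w Kw) e e0) h := cP.
  apply: (@filterS _ (nbhs w) _ _ _ _ h) => t ht /half_closure /ht.
  by rewrite opprD opprK addrACA addNr addr0.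
- by move=> z /half_closure cz; rewrite subr_ge0; exact: pressure_ge hw _ cz.
- move=> z [h1 h2 h3] h4; rewrite subr_gt0; apply: (pressure_gt hw); exact: half_inside h1 h4.
- move=> z h1 h2 h4; have fz := half_inside _ (ltW h1) h4.
  exact: (superharmonic_atD (superharmonic_P hw fz) (CR_near_cst _ (- patm))).
have em : 0 < e * (- m) / 2 by rewrite divr_gt0// mulr_gt0// oppr_gt0.
rewrite ltNge; apply/negP => l0.
have [d d0 hd] := surface_limitP hl em.
(* At distance [t] to the left the barrier is [(- m + m ^+ 2 * t - t) * t]; the last bound on [t]
   makes it at least [- m / 2 * t]. *)
pose t := Num.min (d / 2) (Num.min r (- m / (2 * (1 + m ^+ 2)))).
have M0 : 0 < 2 * (1 + m ^+ 2) by rewrite mulr_gt0// ltr_pwDl// sqr_ge0.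
have [t0 td tr tm] : [/\ 0 < t, t < d, t <= r & t <= - m / (2 * (1 + m ^+ 2))].
  rewrite /t !lt_min gt_min !ge_min !lexx/= !orbT; split => //; last by apply/orP; left; lra.
  by rewrite r0 !divr_gt0// oppr_gt0.
have xt : x - t < x by lra.
have fs (s : R) : s \in `]x - t, x[%R -> fluid eta (s, eta x).
  rewrite in_itv/= => /andP[s1 s2]; apply: half_inside => /=.
    by rewrite ler_norml; apply/andP; split; lra.
  by rewrite /linear_form/= subrr mulr0 addr0 nmulr_rgt0//; lra.
have ds (s : R) : s \in `]x - t, x[%R -> is_derive s 1 (fun s => P (s, eta x)) (dx P (s, eta x)).
  by move=> /fs fz; have [] := C1_is_derive P1 fz.
have hb (s : R) : x - t <= s <= x -> half_box (x, eta x) m (-1) r (s, eta x).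
  move=> /andP[s1 s2]; split => /=; first by rewrite ler_norml; apply/andP; split; lra.
    by rewrite subrr normr0 ltW.
  by rewrite /linear_form/= subrr mulr0 addr0 nmulr_rge0//; lra.
have cs : {within `[x - t, x], continuous (fun s => P (s, eta x))}.
  apply/(subspace_continuousP `[x - t, x] (fun s : R => P (s, eta x))) => s /=.
  rewrite in_itv/= => ss; apply/cvgrPdist_lt => e' e'0.
  have /within_continuousP/(_ _ (half_closure _ (hb _ ss)) _ e'0) h := cP.
  have cp : {for s, continuous (fun s : R => (s, eta x))}.
    by apply: (continuous_pair (f := fun s => s)); [exact: cvg_id|exact: cst_continuous].
  have h' := cp _ h.
  apply: (@filterS _ (nbhs s) _ _ _ _ h') => s' hs'; rewrite /= in_itv/= => ss'.
  by rewrite distrC; apply: hs'; exact: half_closure (hb _ ss').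
have [s ss] := MVT xt ds cs.
have fz := fs _ ss; move: ss; rewrite in_itv/= => /andP[s1 s2].
have hx : x - t <= x - t <= x by rewrite lexx/=; lra.
rewrite (sw_dynamic hs) => k2.
have := he _ (hb _ hx).
rewrite (_ : barrier _ _ _ _ = (- m + m ^+ 2 * t - t) * t); last first.
  by rewrite /barrier /linear_form/=; ring.
move=> k1.
(* By [l >= 0] this gives [dx P > - (e * (- m) / 2)] at the mean value point, whereas the growth of
   [P] gives the opposite inequality. *)
have k3 : dx P (s, eta x) > l - e * (- m) / 2.
  have sd : `|s - x| < d by rewrite ltr_norml; apply/andP; split; lra.
  have := hd s (eta x) sd; rewrite subrr normr0 => /(_ d0 fz).
  by rewrite ltr_norml => /andP[_]; lra.
move: tm; rewrite ler_pdivlMr// => tm.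
have k4 : - m / 2 <= - m - t.
  have : t <= t * (1 + m ^+ 2) by rewrite ler_pMr// lerDl sqr_ge0.
  lra.
have k5 : e * (- m / 2 * t) <= P (x - t, eta x) - patm.
  apply: le_trans k1; rewrite ler_pM2l//.
  rewrite ler_pM2r//; apply: (le_trans k4).
  have := mulr_ge0 (sqr_ge0 m) (ltW t0); lra.
have k6 : dx P (s, eta x) * t <= - (e * (- m / 2 * t)).
  have : x - (x - t) = t by ring.
  move=> xtE; rewrite xtE in k2; rewrite -k2; lra.
have : dx P (s, eta x) <= - (e * (- m / 2)).
  rewrite -(ler_pM2r t0); apply: le_trans k6 _.
  by rewrite le_eqVlt; apply/orP; left; apply/eqP; ring.
by lra.
Qed.

End PressureGradient.

(* At a point of the free surface other than a crest, P_x is the limit of P_x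
   from inside the fluid.  At the crest, where the gradient of P has no such
   limit, it is the limit of P_x along the crest-line. *)
Theorem theorem5p1 (R : realType) (g c patm : R) (eta : R -> R)
    (u v P : R * R -> R) (hw : extreme_stokes_wave g c patm eta u v P) :
  [/\ forall z, half_fluid eta z -> dx P z < 0,
      forall z, half_surface eta z ->
        exists2 l : R, dx P z' @[z' --> within (fluid eta) (nbhs z)] --> l & l < 0,
      (forall y : R, y < eta 0 -> dx P (0, y) = 0) /\
        dx P (0, y) @[y --> (eta 0)^'-] --> (0 : R) &
      (forall y : R, y < eta pi -> dx P (pi, y) = 0) /\
        dx P z' @[z' --> within (fluid eta) (nbhs (pi, eta pi))] --> (0 : R)].
Proof.
split.
- by move=> [x y] [/= x0 xp yx]; apply: (dx_pressure_lt0 hw) => //; rewrite x0.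
- by move=> [x y] [/= x0 xp ->]; apply: (surface_limit_lt0 hw); rewrite x0.
- split; first exact: dx_pressure_crest hw.
  apply/cvgrPdist_lt => e e0; near=> y.
  by rewrite (dx_pressure_crest hw) ?subrr ?normr0.
- by split; [exact: dx_pressure_trough hw|exact: trough_limit hw].
Unshelve. all: end_near. Qed.
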